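(* For each $n\in\mathbb Z$ with $N\le n\le N+M$, the $K$-module $V_{(M,N,n)}$ is irreducible.
   Context: Let $k$ be a $p$-adic field of characteristic $0$ with residual characteristic $p>2$ and residue field of order $q>3$; $\mathcal R$ its integer ring, $\mathfrak p$ the maximal ideal. $K=\mathrm{GL}(3,\mathcal R)$. Let $\chi_2,\chi_3$ be restrictions to $\mathcal R^\times$ of characters of $k^\times$. The conductor $\mathrm{cond}(\psi)$ is the least $m\ge0$ with $1+\mathfrak p^m\subseteq\ker\psi$, with the convention that $\mathrm{cond}(\psi)=0$ iff $\psi|_{\mathcal R^\times}=\mathbf 1$. Put $M=\mathrm{cond}(\chi_2)$, $N=\mathrm{cond}(\chi_3)$ and assume $0\le M\le N$, $N>0$, and $\mathrm{cond}(\chi_2\chi_3^{-1})=N$. Let $\mathbf m=(M,N,N)$. $\mathtt T=\{\mathbf c=(c_1,c_2,c_3)\in\mathbb Z^3:0\le c_1,c_2\le c_3\le c_1+c_2\}$, partially ordered componentwise; $\mathtt T_{\mathbf m}=\{\mathbf c\in\mathtt T:\mathbf c\succeq\mathbf m\}$. $C_{\mathbf c}$ is the subgroup of $g=(g_{ij})\in K$ with $g_{21}\in\mathfrak p^{c_1}$, $g_{32}\in\mathfrak p^{c_2}$, $g_{31}\in\mathfrak p^{c_3}$. For $\mathbf c\in\mathtt T_{\mathbf m}$, $\chi_{\mathbf c}(g)=\chi_2(g_{22})\chi_3(g_{33})$ is a character of $C_{\mathbf c}$ (the factor $\chi_2(g_{22})$ is read as $1$ if $M=0$), and $U_{\mathbf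 c}=\mathrm{Ind}_{C_{\mathbf c}}^K\chi_{\mathbf c}$. All $U_{\mathbf c}$ are regarded as subrepresentations of $\mathrm{Ind}_B^K\chi$, where $B$ is the upper triangular subgroup of $K$ and $\chi$ is the character of $B$ given by $b\mapsto\chi_2(b_{22})\chi_3(b_{33})$; then $U_{\mathbf d}\subseteq U_{\mathbf c}$ when $\mathbf d\preceq\mathbf c$. Set $V_{\mathbf c}=U_{\mathbf c}\big/\sum_{\mathbf d\in\mathtt T_{\mathbf m},\,\mathbf d\prec\mathbf c}U_{\mathbf d}$. *)

(* Defs.v *)
From HB Require Import structures.
From mathcomp Require Import all_boot all_order all_algebra.
From mathcomp Require Import ring_quotient complex.
From mathcomp Require Import boolp classical_sets functions cardinality reals.

Set Implicit Arguments.
Unset Strict Implicit.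
Unset Printing Implicit Defensive.

Import Order.TTheory GRing.Theory Num.Theory.
Local Open Scope ring_scope.
Local Open Scope quotient_scope.

Record representation (C : fieldType) (G : groupType) := Representation {
  rep_mod :> lmodType C;
  rep_act : G -> rep_mod -> rep_mod;
  rep_linear : forall g, linear (rep_act g);
  rep_act1 : forall v, rep_act 1%g v = v;
  rep_actM : forall g h v, rep_act (g * h)%g v = rep_act g (rep_act h v) }.

Record subrep (C : fieldType) (G : groupType) (V : representation C G) :=
  Subrep {
    subrep_pred :> {pred V};
    subrep_closed : submod_closed subrep_pred;
    subrep_stable : forall g v,
      v \in subrep_pred -> rep_act g v \in subrep_pred }.

HB.instance Definition _ (C : fieldType) (G : groupType)
  (V : representation C G) (W : subrep V) :=
  GRing.isSubmodClosed.Build C V (subrep_pred W) (subrep_closed W).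

Definition irreducible (C : fieldType) (G : groupType)
    (V : representation C G) : Prop :=
  (exists v : V, v != 0) /\
  forall W : subrep V, (forall v, v \in W -> v = 0) \/ (forall v, v \in W).

Section SubQuotient.
Variables (C : fieldType) (G : groupType) (V : representation C G).

Section Sub.
Variable W : subrep V.

Definition sub_mod := {v : V | v \in W}.
HB.instance Definition _ := SubChoice.on sub_mod.
HB.instance Definition _ :=
  GRing.SubChoice_isSubLmodule.Build C V (subrep_pred W) sub_mod
    (GRing.submod_closed_semi (subrep_closed W)).

Definition sub_act (g : G) (v : sub_mod) : sub_mod :=
  exist _ (rep_act g (val v)) (subrep_stable g (valP v)).

Lemma sub_act_linear g : linear (sub_act g).
Proof. by move=> a u v; apply: val_inj; rewrite /= rep_linear. Qed.

Lemma sub_act1 v : sub_act 1%g v = v.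
Proof. by apply: val_inj; rewrite /= rep_act1. Qed.

Lemma sub_actM g h v : sub_act (g * h)%g v = sub_act g (sub_act h v).
Proof. by apply: val_inj; rewrite /= rep_actM. Qed.

Definition sub_rep : representation C G :=
  Representation sub_act_linear sub_act1 sub_actM.

End Sub.

Section Quot.
Variable W : subrep V.

Definition quot_mod := Quotient.quot (subrep_pred W).
HB.instance Definition _ := GRing.Zmodule.on quot_mod.

Definition quot_scale (a : C) (x : quot_mod) : quot_mod :=
  \pi_quot_mod (a *: repr x).

Definition quot_act (g : G) (x : quot_mod) : quot_mod :=
  \pi_quot_mod (rep_act g (repr x)).

Lemma quot_eqP (u v : V) :
  reflect (\pi_quot_mod u = \pi_quot_mod v) (u - v \in subrep_pred W).
Proof. by rewrite Quotient.idealrBE; apply: (iffP idP) => [/eqP|->]. Qed.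

Lemma repr_sub (u : V) : repr (\pi_quot_mod u) - u \in subrep_pred W.
Proof. by apply/quot_eqP; rewrite reprK. Qed.

Lemma quot_scaleE a u : quot_scale a (\pi_quot_mod u) = \pi_quot_mod (a *: u).
Proof. by apply/quot_eqP; rewrite -scalerBr rpredZ ?repr_sub. Qed.

Lemma quot_actE g u :
  quot_act g (\pi_quot_mod u) = \pi_quot_mod (rep_act g u).
Proof.
apply/quot_eqP; have := subrep_stable g (repr_sub u).
by rewrite -scaleN1r addrC rep_linear scaleN1r addrC.
Qed.

Lemma quot_addE u v :
  \pi_quot_mod u + \pi_quot_mod v = \pi_quot_mod (u + v).
Proof. by rewrite [RHS]Quotient.pi_add. Qed.

Lemma quot_scaleA a b x :
  quot_scale a (quot_scale b x) = quot_scale (a * b) x.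
Proof. by rewrite -[x]reprK (quot_scaleE b) !quot_scaleE scalerA. Qed.

Lemma quot_scale1 : left_id 1 quot_scale.
Proof. by move=> x; rewrite -[x]reprK !quot_scaleE scale1r. Qed.

Lemma quot_scaleDr : right_distributive quot_scale +%R.
Proof.
move=> a x y; rewrite -[x]reprK -[y]reprK.
by rewrite quot_addE !quot_scaleE quot_addE scalerDr.
Qed.

Lemma quot_scaleDl x : {morph quot_scale^~ x : a b / a + b}.
Proof. by move=> a b; rewrite -[x]reprK !quot_scaleE quot_addE scalerDl. Qed.

HB.instance Definition _ := GRing.Zmodule_isLmodule.Build C quot_mod
  quot_scaleA quot_scale1 quot_scaleDr quot_scaleDl.

Lemma quot_act_linear g : linear (quot_act g).
Proof.
move=> a x y; rewrite -[x]reprK -[y]reprK -[a *: _]/(quot_scale _ _).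
rewrite quot_scaleE quot_addE !quot_actE -[a *: _]/(quot_scale _ _).
by rewrite quot_scaleE quot_addE rep_linear.
Qed.

Lemma quot_act1 x : quot_act 1%g x = x.
Proof. by rewrite -[x]reprK quot_actE rep_act1. Qed.

Lemma quot_actM g h x : quot_act (g * h)%g x = quot_act g (quot_act h x).
Proof. by rewrite -[x]reprK (quot_actE h) !quot_actE rep_actM. Qed.

Definition quot_rep : representation C G :=
  Representation quot_act_linear quot_act1 quot_actM.

End Quot.

(* The intersection W' :&: W, viewed inside W. *)
Section Restrict.
Variables W W' : subrep V.

Definition restr_pred : {pred sub_rep W} := [pred v | val v \in W'].

Lemma restr_closed : submod_closed restr_pred.
Proof.
split=> [|a u v hu hv]; rewrite inE; first exact: (rpred0 (subrep_pred W')).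
by apply: (rpredD (_ : a *: val u \in subrep_pred W') hv); apply: rpredZ hu.
Qed.

Lemma restr_stable g v : v \in restr_pred -> rep_act g v \in restr_pred.
Proof. exact: subrep_stable. Qed.

Definition restr_subrep : subrep (sub_rep W) :=
  Subrep restr_closed restr_stable.

End Restrict.

Section Sum.
Variables (I : Type) (P : set I) (W : I -> subrep V).

Definition sum_pred : {pred V} := fun v => `[<
  exists (n : nat) (w : 'I_n -> V),
    (forall j, exists2 i, P i & w j \in W i) /\ v = \sum_j w j >].

Lemma sum_closed : submod_closed sum_pred.
Proof.
split=> [|a u v /asboolP[m [w [hw ->]]] /asboolP[n [z [hz ->]]]]; apply/asboolP.
  exists 0%N, (fun=> 0); split; [by case | by rewrite big_ord0].
exists (m + n)%N,
  (fun j => match fintype.split j with inl i => a *: w i | inr i => z i end).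
split=> [j|].
  case: fintype.splitP => i _; last exact: hz.
  by have [l Pl wl] := hw i; exists l => //; rewrite rpredZ.
rewrite big_split_ord scaler_sumr; congr (_ + _); apply: eq_bigr => i _.
  by rewrite (unsplitK (inl i)).
by rewrite (unsplitK (inr i)).
Qed.

Lemma sum_stable g v : v \in sum_pred -> rep_act g v \in sum_pred.
Proof.
move=> /asboolP[n [w [hw ->]]]; apply/asboolP; exists n, (rep_act g \o w).
split=> [j|]; first by have [l Pl wl] := hw j; exists l; rewrite ?subrep_stable.
have act0 : rep_act g (0 : V) = 0.
  by have := rep_linear g (-1) 0 (0 : V); rewrite !scaleN1r oppr0 addr0 addNr.
apply: (big_morph (rep_act g)) => // x y.
by have := rep_linear g 1 x y; rewrite !scale1r.
Qed.

Definition sum_subrep : subrep V := Subrep sum_closed sum_stable.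

End Sum.

End SubQuotient.

(* The n-th power of the maximal ideal for a valuation [v : k -> int], whose
   value at 0 is irrelevant. *)
Definition pideal_of (k : fieldType) (v : k -> int) (n : int) : {pred k} :=
  [pred x | (x == 0) || (n <= v x)].

Definition residue_field_of (k : fieldType) (v : k -> int) : set (set k) :=
  [set [set y | y - x \in pideal_of v 1]%classic
     | x in [set x | x \in pideal_of v 0]]%classic.

(* Fields of characteristic 0, complete for a normalized discrete valuation,
   with finite residue field. *)
Record padicField := PadicField {
  pf_sort :> fieldType;
  pval : pf_sort -> int;
  pvalM : forall x y, x != 0 -> y != 0 -> pval (x * y) = pval x + pval y;
  pvalD : forall x y, x != 0 -> y != 0 -> x + y != 0 ->
    Num.min (pval x) (pval y) <= pval (x + y);
  pval_uniformizer : exists2 x, x != 0 & pval x = 1;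
  pf_complete : forall u : nat -> pf_sort,
    (forall n, exists m, forall i j, (m <= i)%N -> (m <= j)%N ->
       u i - u j \in pideal_of pval n) ->
    exists l, forall n, exists m, forall i, (m <= i)%N ->
       u i - l \in pideal_of pval n;
  pf_char0 : [pchar pf_sort] =i pred0;
  pf_residue_finite : finite_set (residue_field_of pval) }.

Section PadicField.
Variable k : padicField.

Definition pideal (n : int) : {pred k} := pideal_of (@pval k) n.
Definition integer_ring : {pred k} := pideal 0.
Definition residue_field : set (set k) := residue_field_of (@pval k).

Definition residue_char (p : nat) : Prop := prime p /\ (p%:R : k) \in pideal 1.

(* The filtration of the units of the integer ring: all units for m = 0,
   1 + p^m for m > 0. *)
Definition unit_group (m : nat) : {pred k} :=
  [pred x | if m == 0%N then (x != 0) && (pval x == 0) else x - 1 \in pideal m].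

Lemma pval1 : pval (1 : k) = 0.
Proof.
have := pvalM (oner_neq0 k) (oner_neq0 k); rewrite mulr1 => h.
by apply: (addrI (pval (1 : k))); rewrite addr0 -h.
Qed.

Lemma integer1 : 1 \in integer_ring.
Proof. by rewrite inE pval1 lexx orbT. Qed.

Lemma pideal0 n : 0 \in pideal n.
Proof. by rewrite inE eqxx. Qed.

Lemma pidealM m n x y :
  x \in pideal m -> y \in pideal n -> x * y \in pideal (m + n).
Proof.
rewrite !inE; have [->|x0] := eqVneq x 0; first by rewrite mul0r eqxx.
have [->|y0] := eqVneq y 0; first by rewrite mulr0 eqxx.
by rewrite /= mulf_eq0 (negPf x0) (negPf y0) pvalM //; apply: lerD.
Qed.

Lemma pidealD n : {in pideal n &, forall x y, x + y \in pideal n}.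
Proof.
move=> x y; rewrite !inE.
have [->|x0] := eqVneq x 0; first by rewrite add0r.
have [->|y0] := eqVneq y 0; first by rewrite addr0 (negPf x0).
rewrite /= => hx hy; have [//|xy0 /=] := eqVneq (x + y) 0.
by apply: le_trans (pvalD x0 y0 xy0); rewrite le_min hx.
Qed.

Definition pideal_mx (n : int) : {pred 'M[k]_3} := mxOver (pideal n).
Definition integer_mx : {pred 'M[k]_3} := mxOver integer_ring.

Lemma pideal_mxM m n (g h : 'M[k]_3) :
  g \in pideal_mx m -> h \in pideal_mx n -> g * h \in pideal_mx (m + n).
Proof.
move=> /mxOverP hg /mxOverP hh; apply/mxOverP => i j; rewrite mxE.
apply: (big_ind (fun x => x \in pideal (m + n))) => [||l _].
- exact: pideal0.
- exact: pidealD.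
- exact: pidealM.
Qed.

Lemma integer_mx1 : 1 \in integer_mx.
Proof.
apply/mxOverP => i j; rewrite mxE; case: (i == j); first exact: integer1.
exact: pideal0.
Qed.

Lemma integer_mxM : {in integer_mx &, forall g h, g * h \in integer_mx}.
Proof. by move=> g h gi hi; apply: (@pideal_mxM 0 0). Qed.

Definition gl3_pred : {pred 'M[k]_3} :=
  [pred g | [&& g \is a GRing.unit, g \in integer_mx & g^-1 \in integer_mx]].

Lemma gl3_1 : 1 \in gl3_pred.
Proof. by rewrite inE unitr1 invr1 integer_mx1. Qed.

Lemma gl3_M : {in gl3_pred &, forall g h, g * h \in gl3_pred}.
Proof.
move=> g h /and3P[gu gi gi'] /and3P[hu hi hi'].
by apply/and3P; split; rewrite ?unitrMl ?invrM ?integer_mxM.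
Qed.

Lemma gl3_V : {in gl3_pred, forall g, g^-1 \in gl3_pred}.
Proof.
by move=> g /and3P[gu gi gi']; apply/and3P; split; rewrite ?unitrV ?invrK.
Qed.

Definition GL3 := {g : 'M[k]_3 | g \in gl3_pred}.
HB.instance Definition _ := SubChoice.on GL3.

Definition gl3_one : GL3 := exist _ 1 gl3_1.
Definition gl3_mul (g h : GL3) : GL3 :=
  exist _ (val g * val h) (gl3_M (valP g) (valP h)).
Definition gl3_inv (g : GL3) : GL3 := exist _ (val g)^-1 (gl3_V (valP g)).

Lemma gl3_unit (g : GL3) : val g \is a GRing.unit.
Proof. by have /and3P[] := valP g. Qed.

Lemma gl3_mulA : associative gl3_mul.
Proof. by move=> g h l; apply: val_inj; rewrite /= mulrA. Qed.

Lemma gl3_mul1 : left_id gl3_one gl3_mul.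
Proof. by move=> g; apply: val_inj; rewrite /= mul1r. Qed.

Lemma gl3_mulr1 : right_id gl3_one gl3_mul.
Proof. by move=> g; apply: val_inj; rewrite /= mulr1. Qed.

Lemma gl3_mulV : left_inverse gl3_one gl3_inv gl3_mul.
Proof. by move=> g; apply: val_inj; rewrite /= mulVr ?gl3_unit. Qed.

Lemma gl3_mulrV : right_inverse gl3_one gl3_inv gl3_mul.
Proof. by move=> g; apply: val_inj; rewrite /= mulrV ?gl3_unit. Qed.

HB.instance Definition _ := isGroup.Build GL3
  gl3_mulA gl3_mul1 gl3_mulr1 gl3_mulV gl3_mulrV.

(* Entries with the 1-based indices of the mathematical notation. *)
Definition entry (g : GL3) (i j : nat) : k := val g (inord i.-1) (inord j.-1).

Definition congruence_subgroup (n : nat) : set GL3 :=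
  [set h : GL3 | val h - 1 \in pideal_mx n]%classic.

Definition triple : Type := int * int * int.

Definition Tset : set triple := fun '(c1, c2, c3) =>
  [/\ 0 <= c1 <= c3, 0 <= c2 <= c3 & c3 <= c1 + c2].

Definition triple_le (c d : triple) : Prop :=
  let: (c1, c2, c3) := c in let: (d1, d2, d3) := d in
  [/\ c1 <= d1, c2 <= d2 & c3 <= d3].

Definition triple_lt (c d : triple) : Prop := triple_le c d /\ c <> d.

Definition Tset_above (m : triple) : set triple :=
  fun c => Tset c /\ triple_le m c.

Definition Cgroup (c : triple) : set GL3 := fun g =>
  let: (c1, c2, c3) := c in
  [/\ entry g 2 1 \in pideal c1, entry g 3 2 \in pideal c2 &
      entry g 3 1 \in pideal c3].

Definition Bgroup : set GL3 := fun g =>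
  [/\ entry g 2 1 = 0, entry g 3 2 = 0 & entry g 3 1 = 0].

Section Characters.
Variable R : realType.
Local Notation C := R[i].

(* Characters of the multiplicative group of k; their values at 0 are
   irrelevant. *)
Definition character (chi : k -> C) : Prop :=
  [/\ forall x, x != 0 -> chi x != 0,
      forall x y, x != 0 -> y != 0 -> chi (x * y) = chi x * chi y &
      forall x, x != 0 -> forall e : C, 0 < e -> exists n : int,
        forall y, y != 0 -> y - x \in pideal n -> `|chi y - chi x| < e].

Definition trivial_on (A : {pred k}) (chi : k -> C) : Prop :=
  forall x, x \in A -> chi x = 1.

Definition conductor (chi : k -> C) (m : nat) : Prop :=
  trivial_on (unit_group m) chi /\
  forall j, (j < m)%N -> ~ trivial_on (unit_group j) chi.

Definition rtrans (g : GL3) (f : GL3 -> C) : GL3 -> C := fun x => f (x * g)%g.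

Lemma rtrans_linear g : linear (rtrans g).
Proof. by []. Qed.

Lemma rtrans1 f : rtrans 1%g f = f.
Proof. by apply/funext => x; rewrite /rtrans mulg1. Qed.

Lemma rtransM g h f : rtrans (g * h)%g f = rtrans g (rtrans h f).
Proof. by apply/funext => x; rewrite /rtrans mulgA. Qed.

Definition rtrans_rep : representation C GL3 :=
  Representation rtrans_linear rtrans1 rtransM.

Definition smooth (f : GL3 -> C) : Prop :=
  exists n : nat, forall h, congruence_subgroup n h ->
    forall x, f (x * h)%g = f x.

Definition Ind_pred (H : set GL3) (psi : GL3 -> C) : {pred rtrans_rep} :=
  fun f => `[< smooth f /\ forall h, H h -> forall x, f (h * x)%g = psi h * f x >].

Lemma Ind_closed H psi : submod_closed (Ind_pred H psi).
Proof.
split=> [|a f1 f2 /asboolP[[m f1m] f1H] /asboolP[[n f2n] f2H]]; apply/asboolP.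
  by split=> [|h _ x]; [exists 0%N | rewrite mulr0].
have E x : (a *: f1 + f2 : GL3 -> C) x = a * f1 x + f2 x by [].
split=> [|h hH x]; last by rewrite !E f1H // f2H // mulrDr mulrCA.
exists (maxn m n) => h /mxOverP hmn x.
have hle l : (l <= maxn m n)%N -> congruence_subgroup l h.
  move=> le_l; apply/mxOverP => i j; have := hmn i j.
  rewrite !inE => /orP[->//|] /(le_trans _) ->; by rewrite ?orbT ?lez_nat.
by rewrite !E f1m ?f2n //; apply: hle; rewrite (leq_maxl, leq_maxr).
Qed.

Lemma Ind_stable H psi g f :
  f \in Ind_pred H psi -> rep_act g f \in Ind_pred H psi.
Proof.
move=> /asboolP[[n fn] fH]; apply/asboolP; split; last first.
  by move=> h hH x; have := fH h hH (x * g)%g; rewrite mulgA.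
exists n => h hn x; rewrite /= /rtrans.
have -> : (x * h * g = x * g * (g^-1 * h * g))%g by rewrite !mulgA mulgK.
apply: fn; rewrite /congruence_subgroup /=.
have -> : val (g^-1 * h * g)%g - 1 = (val g)^-1 * (val h - 1) * val g.
  by rewrite mulrBr mulrBl mulr1 mulVr ?gl3_unit.
have /and3P[_ gi gi'] := valP g.
by rewrite -[n : int]addr0 pideal_mxM // -[n : int]add0r pideal_mxM.
Qed.

(* The smooth induced representation from H to GL3, for g acting by right
   translation; for H open, smoothness is automatic when psi is smooth. *)
Definition Ind (H : set GL3) (psi : GL3 -> C) : subrep rtrans_rep :=
  Subrep (@Ind_closed H psi) (@Ind_stable H psi).

Section Modules.
Variables (chi2 chi3 : k -> C) (M N : nat).

Definition chi_B (g : GL3) : C := chi2 (entry g 2 2) * chi3 (entry g 3 3).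

(* When M = 0, g_22 need not be a unit for g in Cgroup c. *)
Definition chi_C (g : GL3) : C :=
  (if M == 0%N then 1 else chi2 (entry g 2 2)) * chi3 (entry g 3 3).

Definition principal_series : subrep rtrans_rep := Ind Bgroup chi_B.

Definition U (c : triple) : subrep rtrans_rep := Ind (Cgroup c) chi_C.

Definition U_below (c : triple) : subrep rtrans_rep :=
  sum_subrep [set d | Tset_above (M%:Z, N%:Z, N%:Z) d /\ triple_lt d c]%classic U.

Definition V (c : triple) : representation C GL3 :=
  quot_rep (restr_subrep (U c) (U_below c)).

Lemma U_mono c d : triple_le d c -> {subset U d <= U c}.
Proof.
case: c d => [[c1 c2] c3] [[d1 d2] d3] [le1 le2 le3] f /asboolP[fs fH].
apply/asboolP; split=> // h [h1 h2 h3]; apply: fH.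
have le_pideal m n x : m <= n -> x \in pideal n -> x \in pideal m.
  by move=> le_mn; rewrite !inE => /orP[->//|/(le_trans le_mn) ->]; rewrite orbT.
by split; [apply: le_pideal h1 | apply: le_pideal h2 | apply: le_pideal h3].
Qed.

Lemma Bgroup_unit2 (b : GL3) : Bgroup b -> entry b 2 2 \in unit_group 0.
Proof.
case; rewrite /entry /= => b21 b32 b31; have /and3P[bu bi bi'] := valP b.
set i0 : 'I_3 := inord 0 in b21 b31 *; set i1 : 'I_3 := inord 1 in b21 b32 *.
set i2 : 'I_3 := inord 2 in b32 b31 *.
have sum3 (F : 'I_3 -> k) : \sum_l F l = F i0 + F i1 + F i2.
  rewrite !big_ord_recl big_ord0 addr0 addrA.
  by congr (F _ + F _ + F _); apply/val_inj; rewrite /= inordK.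
have e i j : \sum_l (val b)^-1 i l * val b l j = (i == j)%:R.
  by have := congr1 (fun A : 'M[k]_3 => A i j) (mulVr bu); rewrite !mxE.
have := e i0 i0; have := e i1 i0; have := e i1 i1.
have -> : (i1 == i0) = false by apply/negbTE/eqP => /(congr1 val); rewrite /= !inordK.
rewrite !sum3 b21 b31 b32 !mulr0 !addr0 !eqxx /= => e11 e10 e00.
have b00 : val b i0 i0 != 0.
  by apply/eqP => b0; move: e00; rewrite b0 mulr0 => /esym/eqP; rewrite oner_eq0.
have b10' : (val b)^-1 i1 i0 = 0.
  by move/eqP: e10; rewrite mulf_eq0 (negPf b00) orbF => /eqP.
move: e11; rewrite b10' mul0r add0r => e11.
have [x0 y0] : (val b)^-1 i1 i1 != 0 /\ val b i1 i1 != 0.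
  by apply/andP; rewrite -negb_or -mulf_eq0 e11 oner_eq0.
have := pvalM x0 y0; rewrite e11 pval1 => /esym/eqP; rewrite addr_eq0 => /eqP vx.
move/mxOverP/(_ i1 i1): bi'; move/mxOverP/(_ i1 i1): bi.
rewrite !inE (negPf x0) (negPf y0) /= vx oppr_ge0 => ge0 le0.
by rewrite eq_le ge0 le0.
Qed.

Lemma U_principal c : conductor chi2 M -> {subset U c <= principal_series}.
Proof.
case: c => [[c1 c2] c3] [chi2M _] f /asboolP[fs fH]; apply/asboolP.
split=> // h hB x; rewrite fH; last first.
  by case: hB => b21 b32 b31; split; rewrite ?b21 ?b32 ?b31 pideal0.
congr (_ * _ * _); case: eqP => // M0.
by apply/esym/chi2M; rewrite M0 Bgroup_unit2.
Qed.

End Modules.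

End Characters.
End PadicField.

Arguments residue_field : clear implicits.

(* Main.v *)
Require Import Defs.
From HB Require Import structures.
From mathcomp Require Import all_boot all_order all_algebra.
From mathcomp Require Import complex ring.
From mathcomp Require Import boolp classical_sets functions cardinality reals.

(** Write [C_n] for [Cgroup (M, N, n)], [U_n] for the module it induces and
    [chi] for its character. The triples of [Tset] between [(M, N, N)] and
    [(M, N, n)] form the chain [(M, N, j)], [N <= j <= n], so that the module to
    study is [U_n / U_(n-1)], or [U_N] itself when [n = N].

    Let [e_n] be the function equal to [chi] on [C_n] and to 0 elsewhere. Its
    translates span [U_n] ([chi_ext_generates]). Conversely, a submodule
    containing some [f] with [f 1 <> 0] also contains the average of [f] over
    [C_n] against [chi], which is nonzero at 1 and is biequivariant, that is,
    transforms by [chi] under [C_n] on both sides. Everything therefore rests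
    on the determination of the biequivariant functions.

    A biequivariant [f] vanishes at [g] as soon as [c * g = g * c'] for some
    [c], [c'] in [C_n] with [chi c <> chi c']. Taking for [c] and [c'] the
    identity plus a matrix of rank one built from a column and a row of [g]
    ([transvection_pair]), one obtains [1 + x * g31] and [1 + x * g21] as values
    of diagonal entries for arbitrary integral [x]. Since the conductors of
    [chi2], [chi3] and [chi2 / chi3] are [M], [N] and [N], this forces [g] into
    [C_N] when [f g <> 0] ([biequivariant_support]). In turn, [C_N] is the
    product of the group of elementary matrices [lower31 z], for [z] in the
    [N]-th power of the maximal ideal, and of [C_n]; conjugation by
    [diag (t, 1, 1)] shows that [f (lower31 z)] depends only on the valuation of
    [z]. So the biequivariant functions are spanned by [e_N, ..., e_n], and
    each of them is a multiple of [e_n] modulo [U_(n-1)]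
    ([biequivariant_step]).

    Now let [X] be a submodule with [U_(n-1)] contained in [X], and [f] in [X]
    belong to [U_n] but not to [U_(n-1)]. Subtracting from [f] its projection to
    [U_(n-1)], translating and averaging, one finds a nonzero biequivariant [h]
    in [X] with zero projection to [U_(n-1)]. By the above, [h - a e_n] lies in
    [U_(n-1)] for some [a], and [a <> 0] because otherwise [h] would be its own
    projection. Hence [e_n] belongs to [X], and [X] contains [U_n].

    The projection and the averages are finite sums over the quotient of GL(3)
    by a principal congruence subgroup, which is finite because the residue
    field is. *)

Set Implicit Arguments.
Unset Strict Implicit.
Unset Printing Implicit Defensive.

Import Order.TTheory GRing.Theory Num.Theory.
Local Open Scope ring_scope.

(** * Valuation arithmetic *)

Section Valuation.
Variable k : padicField.
Implicit Types x y z : k.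
Local Notation Rk := (@integer_ring k).

Lemma pval_oppr x : x != 0 -> pval (- x) = pval x.
Proof.
move=> x0; have m0 : (-1 : k) != 0 by rewrite oppr_eq0 oner_eq0.
have := pvalM m0 m0; rewrite mulrNN mulr1 pval1 => h.
have v1 : pval (-1 : k) = 0.
  by apply/eqP; move/esym/eqP: h; rewrite -mulr2n mulrn_eq0.
by rewrite -mulN1r pvalM // v1 add0r.
Qed.

Lemma pval_inv x : x != 0 -> pval x^-1 = - pval x.
Proof.
move=> x0; apply: (addrI (pval x)).
by rewrite -pvalM ?invr_eq0 // mulfV // pval1 subrr.
Qed.

Lemma pval_exp x (n : nat) : x != 0 -> pval x = 1 -> pval (x ^+ n) = n%:Z.
Proof.
move=> x0 vx; elim: n => [|n IHn]; first by rewrite expr0 pval1.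
by rewrite exprS pvalM ?expf_neq0 // vx IHn -addn1 PoszD addrC.
Qed.

Lemma pideal_zmod_closed n : zmod_closed (pideal (k:=k) n).
Proof.
split=> [|x y hx hy]; first exact: pideal0.
apply: pidealD => //; move: hy; rewrite !inE.
have [->|y0 /=] := eqVneq y 0; first by rewrite oppr0 eqxx.
by rewrite pval_oppr // => ->; rewrite orbT.
Qed.

HB.instance Definition _ n :=
  GRing.isZmodClosed.Build k (pideal (k:=k) n) (pideal_zmod_closed n).

Lemma pideal_le m n x : m <= n -> x \in pideal n -> x \in pideal m.
Proof. by move=> mn; rewrite !inE => /orP[->//|/(le_trans mn)->]; rewrite orbT. Qed.

Lemma pideal_mull n x y :
  x \in Rk -> y \in pideal n -> x * y \in pideal n.
Proof. by move=> hx hy; rewrite -[n]add0r pidealM. Qed.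

Lemma pideal_mulr n x y :
  x \in pideal n -> y \in Rk -> x * y \in pideal n.
Proof. by move=> hx hy; rewrite mulrC pideal_mull. Qed.

Lemma unit0E x : (x \in unit_group 0) = (x != 0) && (pval x == 0).
Proof. by []. Qed.

Lemma unit_neq0 x : x \in unit_group 0 -> x != 0.
Proof. by rewrite unit0E => /andP[]. Qed.

Lemma unit_integer x : x \in unit_group 0 -> x \in Rk.
Proof. by rewrite unit0E inE => /andP[_ /eqP->]; rewrite lexx orbT. Qed.

Lemma unit_inv x : x \in unit_group 0 -> x^-1 \in unit_group 0.
Proof.
rewrite !unit0E => /andP[x0 /eqP vx].
by rewrite invr_eq0 x0 pval_inv // vx oppr0 eqxx.
Qed.

Lemma unitM x y :
  x \in unit_group 0 -> y \in unit_group 0 -> x * y \in unit_group 0.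
Proof.
rewrite !unit0E => /andP[x0 /eqP vx] /andP[y0 /eqP vy].
by rewrite mulf_neq0 // pvalM // vx vy.
Qed.

Lemma unit1 : (1 : k) \in unit_group 0.
Proof. by rewrite unit0E oner_eq0 pval1 eqxx. Qed.

Lemma pideal_unit_mull n x y :
  x \in unit_group 0 -> (x * y \in pideal n) = (y \in pideal n).
Proof.
move=> ux; apply/idP/idP; last by apply: pideal_mull; apply: unit_integer.
move=> h; rewrite -[y](mulKf (unit_neq0 ux)).
by apply: pideal_mull h; apply/unit_integer/unit_inv.
Qed.

Lemma pideal_unit_mulr n x y :
  x \in unit_group 0 -> (y * x \in pideal n) = (y \in pideal n).
Proof. by move=> ux; rewrite mulrC pideal_unit_mull. Qed.

Lemma notin_pideal n x : (x \notin pideal n) = (x != 0) && (pval x < n).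
Proof. by rewrite inE negb_or -ltNge. Qed.

Lemma integer_unit x :
  x \in Rk -> (x \in unit_group 0) = (x \notin pideal 1).
Proof.
rewrite notin_pideal unit0E inE; have [//|x0 /= hx] := eqVneq x 0.
by rewrite (ltzD1 (pval x) 0) eq_le hx andbT.
Qed.

Lemma oner_pideal1 : (1 : k) \notin pideal 1.
Proof. by rewrite -integer_unit ?unit1 // integer1. Qed.

Lemma unit_of_mul x y z :
  x \in Rk -> y \in Rk -> z \in pideal 1 ->
  x * y + z = 1 -> x \in unit_group 0.
Proof.
move=> hx hy hz e; rewrite integer_unit //; apply: contra oner_pideal1 => hx1.
by rewrite -e; apply: rpredD => //; apply: pideal_mulr.
Qed.

Lemma unit_addr x z :
  x \in unit_group 0 -> z \in pideal 1 -> x + z \in unit_group 0.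
Proof.
move=> ux hz; have ix := unit_integer ux.
have iz : z \in Rk by apply: pideal_le hz.
rewrite integer_unit; last exact: rpredD.
by move: ux; rewrite integer_unit // rpredDr.
Qed.

Lemma unit_group_sub1 m x : x \in unit_group m -> x - 1 \in pideal m.
Proof.
case: m => [/unit_integer ix|//].
by apply: rpredB => //; apply: integer1.
Qed.

Lemma unit_group_unit m x : x \in unit_group m -> x \in unit_group 0.
Proof.
case: m => // m hx; rewrite -[x](subrK 1) addrC; apply: unit_addr unit1 _.
exact: pideal_le (unit_group_sub1 hx).
Qed.

(** Valuations are integers, so that [c] outside [pideal n] has valuation at most
    [n - 1], whence the gain of 1. *)
Lemma pideal_div n m c z : c \notin pideal n -> z \in pideal (n + m - 1) ->
  z / c \in pideal m.
Proof.
rewrite notin_pideal !inE mulf_eq0 => /andP[c0 vc].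
have [//|z0 /= hz] := eqVneq z 0.
rewrite pvalM ?invr_eq0 // pval_inv // lerBrDl (le_trans _ hz) ?orbT //.
by rewrite addrAC lerD2r -ltzD1 subrK.
Qed.

Variable R : realType.
Implicit Type chi : k -> R[i].

Lemma character1 chi : character chi -> chi 1 = 1.
Proof.
case=> chi0 chiM _; have := chiM 1 1 (oner_neq0 _) (oner_neq0 _).
by rewrite mulr1 -[LHS]mulr1 => /(mulfI (chi0 _ (oner_neq0 _)))/esym.
Qed.

Lemma conductor_congr chi m x y : character chi -> conductor chi m ->
  x \in unit_group 0 -> y \in unit_group 0 -> x - y \in pideal m ->
  chi x = chi y.
Proof.
move=> [chi0 chiM _] [triv _] ux uy hxy.
have [x0 y0] := (unit_neq0 ux, unit_neq0 uy).
rewrite -[x](mulfVK y0) chiM ?mulf_neq0 ?invr_eq0 // triv ?mul1r //.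
case: m triv hxy => [|m] triv hxy; first by rewrite unitM ?unit_inv.
rewrite inE /= -[1](mulfV y0) -mulrBl; apply: pideal_mulr => //.
exact/unit_integer/unit_inv.
Qed.

(** For [x] running over the integers, the units among the [1 + x * c] are those
    congruent to 1 modulo the ideal generated by [c]. By minimality of the
    conductor, [chi] is trivial on them only if [c] is divisible enough. *)
Lemma conductor_detect chi m c : conductor chi m -> c \in Rk ->
  (forall x, x \in Rk -> 1 + x * c \in unit_group 0 ->
    chi (1 + x * c) = 1) ->
  c \in pideal m.
Proof.
move=> [_ min] ic h; apply: contraT => hc.
have hex : exists j, (fun j => c \notin pideal j%:Z) j by exists m.
(* Integrality excludes [j = 0], so that [pval c] is [j - 1]. *)
have [j hj jmin] := ex_minnP hex.
have jm : (j <= m)%N by apply: jmin.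
case: j => [|j] in hj jmin jm; first by move: hj; rewrite ic.
case: (min j jm) => z hz.
have uz := unit_group_unit hz; have hz1 := unit_group_sub1 hz.
have c0 : c != 0 by apply: contraNneq hj => ->; apply: pideal0.
have ez : z = 1 + (z - 1) / c * c by rewrite mulfVK // addrC subrK.
by rewrite ez h -?ez //; apply: (pideal_div hj); rewrite addr0 -addn1 PoszD addrK.
Qed.

End Valuation.

(** * Entries, transvections and the subgroups [Cgroup c] *)

Section Matrices.
Variable k : padicField.
Local Notation Rk := (@integer_ring k).
Implicit Types (g h : GL3 k) (x y z : k).

Lemma inord3_eq :
  [/\ (inord 0 == inord 1 :> 'I_3) = false, (inord 0 == inord 2 :> 'I_3) = false
    & (inord 1 == inord 2 :> 'I_3) = false].
Proof. by split; rewrite -val_eqE /= !inordK. Qed.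

Definition inord3E :=
  let: And3 e01 e02 e12 := inord3_eq in
  (eqxx, e01, e02, e12, etrans (eq_sym _ _) e01, etrans (eq_sym _ _) e02,
   etrans (eq_sym _ _) e12).

Lemma sum_inord3 (F : 'I_3 -> k) :
  \sum_l F l = F (inord 0) + F (inord 1) + F (inord 2).
Proof.
rewrite !big_ord_recl big_ord0 addr0 addrA.
by congr (F _ + F _ + F _); apply/val_inj; rewrite /= inordK.
Qed.

Lemma ord3_ind (P : 'I_3 -> Prop) :
  P (inord 0) -> P (inord 1) -> P (inord 2) -> forall i, P i.
Proof.
move=> P0 P1 P2 [[|[|[|//]]] i3].
- by rewrite (_ : Ordinal _ = inord 0) //; apply/val_inj; rewrite /= inordK.
- by rewrite (_ : Ordinal _ = inord 1) //; apply/val_inj; rewrite /= inordK.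
- by rewrite (_ : Ordinal _ = inord 2) //; apply/val_inj; rewrite /= inordK.
Qed.

Lemma entryM g h i j : entry (g * h)%g i j =
  entry g i 1 * entry h 1 j + entry g i 2 * entry h 2 j + entry g i 3 * entry h 3 j.
Proof. by rewrite /entry mxE sum_inord3. Qed.

Lemma entry1 i j : entry (1%g : GL3 k) i j = (inord i.-1 == inord j.-1 :> 'I_3)%:R.
Proof. by rewrite /entry mxE. Qed.

Lemma entry_integer g i j : entry g i j \in Rk.
Proof. by have /and3P[_ /mxOverP gi _] := valP g; apply: gi. Qed.
Hint Resolve entry_integer : core.

(** ** Transvections *)

Lemma rank_one_GL3 (u : 'cV[k]_3) (w : 'rV[k]_3) :
    u \is a mxOver Rk -> w \is a mxOver Rk ->
    1 + (w *m u) 0 0 \in unit_group 0 ->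
  exists c : GL3 k, val c = 1 + u *m w.
Proof.
move=> /mxOverP iu /mxOverP iw; set d := 1 + _ => ud.
have iuw : u *m w \in integer_mx (k:=k).
  by apply/mxOverP => i j; rewrite mxE big_ord1 pideal_mull.
have sq : u *m w *m (u *m w) = (d - 1) *: (u *m w).
  rewrite -mulmxA (mulmxA w) [w *m u]mx11_scalar mul_scalar_mx -scalemxAr.
  by rewrite /d [1 + _]addrC addrK.
have inv1 : (1 + u *m w) * (1 - d^-1 *: (u *m w)) = 1.
  rewrite mulrDl mul1r mulrBr mulr1 -scalerAr -[u *m w * _]/(_ *m _) sq scalerA.
  rewrite mulrBr mulVf ?unit_neq0 // mulr1 scalerBl scale1r.
  by rewrite subKr subrK.
have inv2 : (1 - d^-1 *: (u *m w)) * (1 + u *m w) = 1 by apply: mulmx1C.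
have iX : 1 + u *m w \in integer_mx (k:=k).
  by apply: rpredD => //; apply: integer_mx1.
have uX : (1 + u *m w : 'M_3) \is a GRing.unit.
  by apply/unitrP; exists (1 - d^-1 *: (u *m w)).
suff h : 1 + u *m w \in gl3_pred (k:=k) by exists (exist (fun A => A \in gl3_pred (k:=k)) _ h).
apply/and3P; split=> //.
have -> : (1 + u *m w)^-1 = 1 - d^-1 *: (u *m w).
  by apply: (mulrI uX); rewrite mulrV ?inv1.
apply: rpredB; first exact: integer_mx1.
move/mxOverP: iuw => iuw; apply/mxOverP => i j; rewrite mxE.
by apply: pideal_mull => //; apply/unit_integer/unit_inv.
Qed.

(** Both sides of [c * g = g * c'] equal [g] plus [x] times the product of its
    column [p] by its row [q]. Such pairs give explicit elements of the
    intersection of a subgroup with its conjugate by [g], and [1 + x * entry g q p]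
    occurs on both diagonals, as entry [(q, q)] of [c] and [(p, p)] of [c']. *)
Lemma transvection_pair g p q x :
    x \in Rk -> 1 + x * entry g q p \in unit_group 0 ->
  exists c c' : GL3 k, [/\ (c * g = g * c')%g,
    (forall i j, entry c i j = (inord i.-1 == inord j.-1 :> 'I_3)%:R
       + x * entry g i p * (inord q.-1 == inord j.-1 :> 'I_3)%:R) &
    (forall i j, entry c' i j = (inord i.-1 == inord j.-1 :> 'I_3)%:R
       + x * (inord i.-1 == inord p.-1 :> 'I_3)%:R * entry g q j)].
Proof.
move=> ix ud; set P : 'I_3 := inord p.-1; set Q : 'I_3 := inord q.-1.
have idelta (a b : bool) : (a && b)%:R \in Rk.
  by case: (a && b); rewrite ?integer1 ?pideal0.
have ig i j : val g i j \in Rk.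
  by have /and3P[_ /mxOverP gi _] := valP g; apply: gi.
have [||| c ec] := @rank_one_GL3 (x *: col P (val g)) (delta_mx 0 Q).
- by apply/mxOverP => i j; rewrite !mxE pideal_mull.
- by apply/mxOverP => i j; rewrite !mxE.
- by rewrite -scalemxAr -rowE !mxE.
have [||| c' ec'] := @rank_one_GL3 (x *: delta_mx P 0) (row Q (val g)).
- by apply/mxOverP => i j; rewrite !mxE pideal_mull.
- by apply/mxOverP => i j; rewrite !mxE.
- by rewrite -scalemxAr -colE !mxE.
exists c, c'; split=> [|i j|i j].
- apply: val_inj; rewrite /= ec ec' mulrDl mulrDr mul1r mulr1; congr (_ + _).
  rewrite -![_ * _]/(_ *m _) -!scalemxAl -scalemxAr -mulmxA -rowE.
  by rewrite mulmxA -colE.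
- by rewrite /entry ec !mxE big_ord1 !mxE eqxx /= eq_sym (eq_sym Q).
- by rewrite /entry ec' !mxE big_ord1 !mxE eqxx andbT.
Qed.

(** The default value makes this total; only for integral [x] is the elementary
    matrix invertible over the integers. *)
Definition lower31 x : GL3 k :=
  insubd (1%g : GL3 k) (1 + x *: delta_mx (inord 2) (inord 0)).

Lemma entry_lower31 x i j : x \in Rk -> entry (lower31 x) i j =
  (inord i.-1 == inord j.-1 :> 'I_3)%:R +
  x * ((inord i.-1 == inord 2 :> 'I_3) && (inord j.-1 == inord 0 :> 'I_3))%:R.
Proof.
move=> ix; rewrite /entry /lower31.
have [||| c ec] := @rank_one_GL3 (x *: delta_mx (inord 2) 0) (delta_mx 0 (inord 0)).
- apply/mxOverP => a b; rewrite !mxE pideal_mulr //.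
  by case: (_ && _); rewrite ?integer1 ?pideal0.
- apply/mxOverP => a b; rewrite !mxE.
  by case: (_ && _); rewrite ?integer1 ?pideal0.
- rewrite -scalemxAr mul_delta_mx_0; last by rewrite inord3E.
  by rewrite scaler0 mxE addr0 unit1.
move: ec; rewrite -scalemxAl mul_delta_mx => ec.
by rewrite insubdK -?ec ?(valP c) // ec !mxE.
Qed.

Lemma GL3_eq g h : (forall i j, (0 < i <= 3)%N -> (0 < j <= 3)%N ->
  entry g i j = entry h i j) -> g = h.
Proof.
move=> e; apply/val_inj/matrixP => i j.
by elim/ord3_ind: i; elim/ord3_ind: j;
  [have := e 1 1 | have := e 1 2 | have := e 1 3
  |have := e 2 1 | have := e 2 2 | have := e 2 3
  |have := e 3 1 | have := e 3 2 | have := e 3 3]; apply.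
Qed.

End Matrices.

Section Subgroups.
Variable k : padicField.
Local Notation Rk := (@integer_ring k).
Implicit Types (g h : GL3 k) (x y z : k).
Hint Resolve entry_integer : core.

(** ** Closure of [Cgroup c] under products and inverses *)

Definition det3 g : k :=
  entry g 1 1 * (entry g 2 2 * entry g 3 3 - entry g 2 3 * entry g 3 2)
  - entry g 1 2 * (entry g 2 1 * entry g 3 3 - entry g 2 3 * entry g 3 1)
  + entry g 1 3 * (entry g 2 1 * entry g 3 2 - entry g 2 2 * entry g 3 1).

Lemma det3M g h : det3 (g * h)%g = det3 g * det3 h.
Proof. by rewrite /det3 !entryM; ring. Qed.

Lemma det3_integer g : det3 g \in Rk.
Proof. by rewrite /det3; do ?[apply: rpredB | apply: rpredD | apply: pideal_mull]. Qed.

Lemma det3_unit g : det3 g \in unit_group 0.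
Proof.
apply: (@unit_of_mul _ _ (det3 g^-1%g) 0); rewrite ?det3_integer ?pideal0 //.
by rewrite -det3M mulgV addr0 /det3 !entry1 /= !inord3E /=; ring.
Qed.

Lemma entry_mulVg g i j :
  entry g^-1%g i 1 * entry g 1 j + entry g^-1%g i 2 * entry g 2 j
    + entry g^-1%g i 3 * entry g 3 j = (inord i.-1 == inord j.-1 :> 'I_3)%:R.
Proof. by rewrite -entryM mulVg entry1. Qed.

(** Cramer's rule. The minors that occur here lie in the ideals defining
    [Cgroup c], thanks to [c3 <= c1 + c2] for the last one. *)
Lemma det3_inv g :
  [/\ det3 g * entry g^-1%g 2 1 = entry g 2 3 * entry g 3 1 - entry g 2 1 * entry g 3 3,
      det3 g * entry g^-1%g 3 2 = entry g 1 2 * entry g 3 1 - entry g 1 1 * entry g 3 2 &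
      det3 g * entry g^-1%g 3 1 = entry g 2 1 * entry g 3 2 - entry g 2 2 * entry g 3 1].
Proof.
pose cof a b c d := entry g a c * entry g b d - entry g a d * entry g b c.
have cramer i c : (0 < c <= 3)%N ->
    det3 g * entry g^-1%g i c =
    (inord i.-1 == inord 0 :> 'I_3)%:R *
      nth 0 [:: cof 2 3 2 3; - cof 1 3 2 3; cof 1 2 2 3]%N c.-1
  + (inord i.-1 == inord 1 :> 'I_3)%:R *
      nth 0 [:: - cof 2 3 1 3; cof 1 3 1 3; - cof 1 2 1 3]%N c.-1
  + (inord i.-1 == inord 2 :> 'I_3)%:R *
      nth 0 [:: cof 2 3 1 2; - cof 1 3 1 2; cof 1 2 1 2]%N c.-1.
  rewrite -[inord 0]/(inord (1%N.-1)) -(entry_mulVg g i 1).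
  rewrite -[inord 1]/(inord (2%N.-1)) -(entry_mulVg g i 2).
  rewrite -[inord 2]/(inord (3%N.-1)) -(entry_mulVg g i 3).
  by case: c => [|[|[|[|//]]]] //= _; rewrite /det3 /cof; ring.
by split; rewrite cramer //= !inord3E /= /cof; ring.
Qed.

Lemma Cgroup_inv c g : Tset c -> Cgroup c g -> Cgroup c g^-1%g.
Proof.
case: c => [[c1 c2] c3] [/andP[_ le13] /andP[_ le23] le3] [g21 g32 g31].
have [e21 e32 e31] := det3_inv g; have ud := det3_unit g.
split; rewrite -(pideal_unit_mull _ _ ud).
- by rewrite e21; apply: rpredB; [apply: pideal_mull => //; apply: pideal_le g31|
    apply: pideal_mulr].
- by rewrite e32; apply: rpredB; [apply: pideal_mull => //; apply: pideal_le g31|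
    apply: pideal_mull].
- rewrite e31; apply: rpredB; last exact: pideal_mull.
  by apply: pideal_le le3 _; apply: pidealM.
Qed.

Lemma Cgroup_mul c g h : Tset c -> Cgroup c g -> Cgroup c h -> Cgroup c (g * h)%g.
Proof.
case: c => [[c1 c2] c3] [/andP[_ le13] /andP[_ le23] le3] [g21 g32 g31] [h21 h32 h31].
split; rewrite entryM; do 2?[apply: rpredD];
  do 1?[by apply: pideal_mulr | by apply: pideal_mull].
- by apply: pideal_mull => //; apply: pideal_le h31.
- by apply: pideal_mulr => //; apply: pideal_le g31.
- by apply: pideal_le le3 _; rewrite addrC; apply: pidealM.
Qed.

Lemma Cgroup_mull c g h : Tset c -> Cgroup c g -> Cgroup c (g * h)%g <-> Cgroup c h.
Proof.
move=> Tc hg; split=> [hgh|]; last exact: Cgroup_mul.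
by rewrite -(mulKg g h); apply: Cgroup_mul => //; apply: Cgroup_inv.
Qed.

Lemma Cgroup_mulr c g h : Tset c -> Cgroup c g -> Cgroup c (h * g)%g <-> Cgroup c h.
Proof.
move=> Tc hg; split=> [hgh|hh]; last exact: Cgroup_mul.
by rewrite -(mulgK g h); apply: Cgroup_mul => //; apply: Cgroup_inv.
Qed.

Lemma Cgroup_le c d g : triple_le d c -> Cgroup c g -> Cgroup d g.
Proof.
case: c d => [[c1 c2] c3] [[d1 d2] d3] [l1 l2 l3] [h1 h2 h3].
by split; apply: pideal_le; eassumption.
Qed.

Lemma Cgroup1 c : Cgroup c (1%g : GL3 k).
Proof. by case: c => [[c1 c2] c3]; split; rewrite entry1 /= inord3E pideal0. Qed.

Lemma Cgroup_lower31 c1 c2 c3 x : x \in Rk -> x \in pideal c3 ->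
  Cgroup (c1, c2, c3) (lower31 x).
Proof.
move=> ix hx; split; rewrite entry_lower31 //= !inord3E /=;
  by rewrite ?mulr0 ?mulr1 ?add0r ?pideal0.
Qed.

Lemma lower31_mul x y : x \in Rk -> y \in Rk ->
  (lower31 x * lower31 y)%g = lower31 (x + y).
Proof.
move=> ix iy; have ixy : x + y \in Rk by apply: rpredD.
apply: GL3_eq => i j.
case: i => [|[|[|[|//]]]] // _; case: j => [|[|[|[|//]]]] // _;
  by rewrite entryM !(entry_lower31 _ _ ix, entry_lower31 _ _ iy, entry_lower31 _ _ ixy)
    /= !inord3E /=; ring.
Qed.

Lemma lower310 : lower31 (0 : k) = 1%g.
Proof.
by apply: GL3_eq => i j _ _; rewrite entry_lower31 ?pideal0 // entry1 mul0r addr0.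
Qed.

End Subgroups.

(** * Biequivariant functions *)

Section Biequivariant.
Variables (R : realType) (k : padicField) (chi2 chi3 : k -> R[i]).
Hypotheses (hchi2 : character chi2) (hchi3 : character chi3).
Variables (M N : nat).
Hypotheses (hM : conductor chi2 M) (hN : conductor chi3 N).
Hypotheses (hMN : (M <= N)%N) (hN0 : (0 < N)%N).
Local Notation Rk := (@integer_ring k).
Local Notation chi := (chi_C chi2 chi3 M).
Local Notation lev j := (M%:Z, N%:Z, j).
Implicit Types (g h c : GL3 k) (x y z : k) (f : GL3 k -> R[i]) (j n : int).
Hint Resolve entry_integer : core.

Lemma Tset_lev j : N%:Z <= j <= N%:Z + M%:Z -> Tset (lev j).
Proof.
case/andP=> Nj jNM; split; last by rewrite addrC.
- by rewrite lez_nat leq0n (le_trans _ Nj) // lez_nat.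
- by rewrite lez_nat leq0n.
Qed.

Lemma Tset_levN : Tset (lev N%:Z).
Proof. by apply: Tset_lev; rewrite lexx lerDl lez_nat leq0n. Qed.

Lemma Cgroup_levN j g : N%:Z <= j -> Cgroup (lev j) g -> Cgroup (lev N%:Z) g.
Proof. by move=> Nj; apply: Cgroup_le. Qed.

Lemma pideal_pos (m : nat) x : (0 < m)%N -> x \in pideal m%:Z -> x \in pideal 1.
Proof. by move=> m0; apply: pideal_le; rewrite lez_nat. Qed.

Ltac solve_pos := match goal with
  | _ => exact: (pideal_pos hN0)
  | H : is_true (0 < M)%N |- _ => exact: (pideal_pos H)
  end.

Lemma Cgroup_unit33 g : Cgroup (lev N%:Z) g -> entry g 3 3 \in unit_group 0.
Proof.
case=> g21 g32 g31; have := entryM g g^-1%g 3 3.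
rewrite mulgV entry1 eqxx /= [in RHS]addrC => /esym e.
apply: unit_of_mul e => //; apply: rpredD; apply: pideal_mulr => //;
  solve_pos.
Qed.

Lemma Cgroup_unit11 g : (0 < M)%N -> Cgroup (lev N%:Z) g ->
  entry g 1 1 \in unit_group 0.
Proof.
move=> M0 [g21 g32 g31]; have := entry_mulVg g 1 1.
rewrite eqxx /= -addrA mulrC => e; apply: unit_of_mul e => //.
by apply: rpredD; apply: pideal_mull => //; solve_pos.
Qed.

Lemma Cgroup_unit22 g : (0 < M)%N -> Cgroup (lev N%:Z) g ->
  entry g 2 2 \in unit_group 0.
Proof.
move=> M0 hg; have [_ i32 _] := Cgroup_inv Tset_levN hg.
case: hg => g21 g32 g31.
have e : entry g 2 2 * entry g^-1%g 2 2
    + (entry g 2 1 * entry g^-1%g 1 2 + entry g 2 3 * entry g^-1%g 3 2) = 1.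
  by rewrite addrCA addrA -entryM mulgV entry1 eqxx.
apply: unit_of_mul e => //.
apply: rpredD; [apply: pideal_mulr => // | apply: pideal_mull => //];
  solve_pos.
Qed.

(** On [Cgroup (M, N, N)] the diagonal entries multiply modulo the conductors,
    so [chi] is a character there, hence on all smaller [Cgroup c]. *)
Lemma chiM g h : Cgroup (lev N%:Z) g -> Cgroup (lev N%:Z) h ->
  chi (g * h)%g = chi g * chi h.
Proof.
move=> hg hh; have hgh := Cgroup_mul Tset_levN hg hh.
have [_ chi2M _] := hchi2; have [_ chi3M _] := hchi3.
have [ug uh] := (Cgroup_unit33 hg, Cgroup_unit33 hh).
rewrite /chi_C (conductor_congr hchi3 hN (Cgroup_unit33 hgh) (unitM ug uh)); last first.
  case: hg hh => g21 g32 g31 [h21 h32 h31].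
  by rewrite entryM addrK; apply: rpredD; apply: pideal_mulr.
rewrite chi3M ?unit_neq0 // mulrACA; congr (_ * _).
case: eqP => [_|/eqP M0]; first by rewrite mulr1.
rewrite -lt0n in M0; have [vg vh] := (Cgroup_unit22 M0 hg, Cgroup_unit22 M0 hh).
rewrite (conductor_congr hchi2 hM (Cgroup_unit22 M0 hgh) (unitM vg vh)).
  by rewrite chi2M ?unit_neq0.
case: hg hh => g21 g32 g31 [h21 h32 h31].
rewrite entryM addrAC addrK; apply: rpredD; first exact: pideal_mulr.
by apply: pideal_mull => //; apply: pideal_le h32; rewrite lez_nat.
Qed.

Lemma chi1 : chi 1%g = 1.
Proof.
by rewrite /chi_C !entry1 !eqxx (character1 hchi2) (character1 hchi3) mulr1 if_same.
Qed.

Lemma chi_neq0 g : Cgroup (lev N%:Z) g -> chi g != 0.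
Proof.
move=> hg; apply: contra_eq_neq chi1 => e; rewrite -(mulgV g) chiM ?e ?mul0r.
- by rewrite eq_sym oner_eq0.
- by [].
- exact: Cgroup_inv Tset_levN hg.
Qed.

Lemma chiV g : Cgroup (lev N%:Z) g -> chi g^-1%g = (chi g)^-1.
Proof.
move=> hg; apply: (mulfI (chi_neq0 hg)); rewrite mulfV ?chi_neq0 //.
by rewrite -chiM ?mulgV ?chi1 //; apply: Cgroup_inv Tset_levN hg.
Qed.

Lemma chi_lower31 x : x \in Rk -> chi (lower31 x) = 1.
Proof.
move=> ix; rewrite /chi_C !entry_lower31 //= !inord3E /= !mulr0 !addr0.
by rewrite (character1 hchi2) (character1 hchi3) mulr1 if_same.
Qed.

Lemma Cgroup_congruence n (m : nat) g : N%:Z <= n -> n <= m ->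
  congruence_subgroup m g -> Cgroup (lev n) g.
Proof.
move=> Nn nm /mxOverP hg; have h a b : inord a.-1 != inord b.-1 :> 'I_3 ->
    entry g a b \in pideal m%:Z.
  by move=> ab; have := hg (inord a.-1) (inord b.-1); rewrite !mxE (negPf ab) subr0.
by split; [apply: pideal_le (h 2 1 _) | apply: pideal_le (h 3 2 _)
  | apply: pideal_le (h 3 1 _)]; rewrite /= ?inord3E // (le_trans _ nm) //
  (le_trans _ Nn) // lez_nat.
Qed.

Lemma chi_congruence (m : nat) g : (N <= m)%N -> congruence_subgroup m g -> chi g = 1.
Proof.
move=> Nm hg; have hC := Cgroup_congruence (lexx N%:Z) (_ : N%:Z <= m) hg.
have {}hC : Cgroup (lev N%:Z) g by apply: hC; rewrite lez_nat.
move/mxOverP: hg => hg; have h i : entry g i i - 1 \in pideal m%:Z.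
  by have := hg (inord i.-1) (inord i.-1); rewrite !mxE eqxx.
rewrite /chi_C (conductor_congr hchi3 hN (Cgroup_unit33 hC) (unit1 k)); last first.
  by apply: pideal_le (h 3); rewrite lez_nat.
rewrite (character1 hchi3) mulr1; case: eqP => [//|/eqP]; rewrite -lt0n => M0.
rewrite (conductor_congr hchi2 hM (Cgroup_unit22 M0 hC) (unit1 k)) ?(character1 hchi2) //.
by apply: pideal_le (h 2); rewrite lez_nat (leq_trans hMN).
Qed.

Definition biequivariant (n : int) f := forall c g, Cgroup (lev n) c ->
  f (c * g)%g = chi c * f g /\ f (g * c)%g = f g * chi c.

(** The obstruction to the existence of a biequivariant function that is
    nonzero at [g]: [chi] must agree with its conjugate by [g] wherever both
    are defined. *)
Lemma biequivariant_eq n f g c c' : biequivariant n f -> f g != 0 ->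
  Cgroup (lev n) c -> Cgroup (lev n) c' -> (c * g = g * c')%g -> chi c = chi c'.
Proof.
move=> hf fg hc hc' e; apply: (mulIf fg).
by rewrite -(proj1 (hf c g hc)) e (proj2 (hf c' g hc')) mulrC.
Qed.

Hypothesis hMN23 : conductor (fun x => chi2 x / chi3 x) N.

Variables (n : int) (hn : N%:Z <= n <= N%:Z + M%:Z).

(** For the pair with [(p, q) = (1, 3)], both matrices are upper triangular, with
    [chi c = chi3 (1 + x * g31)] and [chi c' = 1]. *)
Lemma biequivariant_entry31 f g : biequivariant n f -> f g != 0 ->
  entry g 3 1 \in pideal N.
Proof.
move=> hf fg; apply: (conductor_detect hN) => // x ix ux.
have [c [c' [e ec ec']]] := transvection_pair ix ux.
have := biequivariant_eq hf fg _ _ e; rewrite /chi_C !ec !ec' /= !inord3E /=.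
rewrite !mulr0 !mul0r !mulr1 !addr0 (character1 hchi2) (character1 hchi3).
rewrite !if_same !mul1r.
by apply; split; rewrite ?ec ?ec' /= !inord3E /= !mulr0 ?mul0r addr0 pideal0.
Qed.

(** Similarly with [(p, q) = (1, 2)]: the entry (3, 2) of [c] is [x * g31], which
    is already known to be small, and [chi c = chi2 (1 + x * g21)]. *)
Lemma biequivariant_entry21 f g : biequivariant n f -> f g != 0 ->
  entry g 2 1 \in pideal M.
Proof.
move=> hf fg; case: (posnP M) => [-> //|M0].
have h31 := biequivariant_entry31 hf fg.
apply: (conductor_detect hM) => // x ix ux.
have [c [c' [e ec ec']]] := transvection_pair ix ux.
have := biequivariant_eq hf fg _ _ e; rewrite /chi_C !ec !ec' /= !inord3E /=.
rewrite !mulr0 !mul0r !mulr1 !addr0 (character1 hchi2) (character1 hchi3).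
rewrite if_same !mulr1 gtn_eqF //.
by apply; split; rewrite ?ec ?ec' /= !inord3E /= ?mulr0 ?mul0r ?mulr1 ?add0r ?addr0
  ?pideal0 // pideal_mull.
Qed.

(** If [M = 0] the subgroup contains GL(2) as a block, and the pair with
    [(p, q) = (2, 3)] works as before. Otherwise the same pair is applied to
    [g^-1]: it compares [chi2] to [chi3] at [1 + y * g'32], where [g'32] is the
    entry of [g^-1], so that the conductor of [chi2 / chi3] controls [g'32], hence
    [g32] because [g31] is already small. *)
Lemma biequivariant_entry32 f g : biequivariant n f -> f g != 0 ->
  entry g 3 2 \in pideal N.
Proof.
move=> hf fg; have h31 := biequivariant_entry31 hf fg.
have h21 := biequivariant_entry21 hf fg.
case: (posnP M) => [M0|M0].
  have nN : n = N%:Z by apply/eqP; rewrite eq_le andbC; move: hn; rewrite M0 addr0.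
  apply: (conductor_detect hN) => // x ix ux.
  have [c [c' [e ec ec']]] := transvection_pair ix ux.
  have := biequivariant_eq hf fg _ _ e; rewrite /chi_C !ec !ec' /= !inord3E /= M0 /=.
  rewrite !mulr0 !mul0r !mulr1 !addr0 (character1 hchi3) !mul1r.
  apply; split; rewrite ?ec ?ec' ?M0 /= !inord3E /= ?mulr0 ?mul0r ?mulr1 ?add0r ?addr0;
    rewrite ?pideal0 // pideal_mull //.
have u11 : entry g 1 1 \in unit_group 0.
  have := entry_mulVg g 1 1; rewrite eqxx /= -addrA mulrC => e.
  apply: unit_of_mul e => //.
  by apply: rpredD; apply: pideal_mull => //; solve_pos.
set g' := g^-1%g.
have i31 : entry g' 3 1 \in pideal M.
  have := entry_mulVg g 3 1; rewrite /= inord3E -addrA => /eqP; rewrite addr_eq0 => /eqP e.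
  rewrite -(pideal_unit_mulr _ _ u11) e rpredN.
  by apply: rpredD; apply: pideal_mull => //; apply: pideal_le h31; rewrite lez_nat.
have i32 : entry g' 3 2 \in pideal N.
  apply: (conductor_detect hMN23) => // y iy uy.
  have [c [c' [e ec ec']]] := transvection_pair iy uy.
  have {}e : (c' * g = g * c)%g by rewrite -[c'](mulVKg g) -/g' -e -!mulgA mulVg mulg1.
  have := biequivariant_eq hf fg _ _ e; rewrite /chi_C !ec !ec' /= !inord3E /=.
  rewrite !mulr0 !mul0r !mulr1 !addr0 (character1 hchi2) (character1 hchi3).
  rewrite if_same !mul1r !mulr1 gtn_eqF // => ->.
  - by have [chi30 _ _] := hchi3; rewrite mulfV // chi30 // unit_neq0.
  - by split; rewrite ?ec' /= !inord3E /= ?mulr0 ?mul0r ?mulr1 ?add0r ?pideal0 // pideal_mull.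
  - by split; rewrite ?ec /= !inord3E /= ?mulr0 ?addr0 ?pideal0.
have u22 : entry g' 2 2 \in unit_group 0.
  have e : entry g' 2 2 * entry g 2 2
      + (entry g 2 1 * entry g' 1 2 + entry g 2 3 * entry g' 3 2) = 1.
    by rewrite [_ * entry g 2 2]mulrC addrCA addrA -entryM mulgV entry1 eqxx.
  apply: unit_of_mul e => //.
  by apply: rpredD; [apply: pideal_mulr => // | apply: pideal_mull => //]; solve_pos.
have := entryM g g' 3 2; rewrite mulgV entry1 /= inord3E addrAC => /esym/eqP.
rewrite addrC addr_eq0 => /eqP e; rewrite -(pideal_unit_mulr _ _ u22) e rpredN.
by apply: rpredD; [apply: pideal_mulr | apply: pideal_mull].
Qed.

Lemma biequivariant_support f g : biequivariant n f -> f g != 0 -> Cgroup (lev N%:Z) g.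
Proof.
move=> hf fg; split; [exact: biequivariant_entry21 hf fg
 | exact: biequivariant_entry32 hf fg | exact: biequivariant_entry31 hf fg].
Qed.

End Biequivariant.

(** * Finite sums over congruence classes *)

Section Congruence.
Variable k : padicField.
Local Notation Rk := (@integer_ring k).
Implicit Types (g h l : GL3 k) (x y z : k).
Local Open Scope classical_set_scope.

Lemma residue_net : exists s : seq k,
  forall x, x \in Rk -> exists2 y, y \in s & x - y \in pideal 1.
Proof.
have /finite_seqP[s es] := pf_residue_finite k.
exists [seq xget 0 A | A <- s] => x ix.
pose A := [set y | y - x \in pideal_of (@pval k) 1].
have : residue_field k A by exists x.
rewrite /residue_field es => /= sA.
exists (xget 0 A); first exact: map_f.
have Ax : A (xget 0 A) by apply: (@xgetPex _ 0 A); exists x; rewrite /A /= subrr inE eqxx.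
by rewrite -[x - _]opprB rpredN.
Qed.

(** Expand an integer to [n] digits in the uniformizer, with digits among
    representatives of the residue field. *)
Lemma pideal_net (n : nat) : exists s : seq k,
  forall x, x \in Rk -> exists2 y, y \in s & x - y \in pideal n.
Proof.
have [p p0 vp] := pval_uniformizer k; have [s1 hs1] := residue_net.
elim: n => [|n [s hs]].
  by exists [:: 0] => x ix; exists 0; rewrite ?inE ?eqxx // subr0.
exists [seq y + p ^+ n * z | y <- s, z <- s1] => x /hs[y ys xy].
have vpn := pval_exp n p0 vp.
have ie : (x - y) / p ^+ n \in Rk.
  apply: (@pideal_div _ n.+1%:Z); last by rewrite addr0 -addn1 PoszD addrK.
  by rewrite notin_pideal expf_neq0 // vpn ltz_nat /=.
have [w ws zw] := hs1 _ ie; exists (y + p ^+ n * w); first exact: allpairs_f.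
have -> : x - (y + p ^+ n * w) = p ^+ n * ((x - y) / p ^+ n - w).
  by rewrite mulrBr mulrCA divff ?expf_neq0 // mulr1 opprD addrA.
rewrite -addn1 PoszD; apply: pidealM => //.
by rewrite !inE vpn lexx orbT.
Qed.

Definition congr_mod (n : nat) : rel (GL3 k) :=
  fun g h => val g - val h \in pideal_mx (k:=k) n.

Lemma congr_mod_sym n : symmetric (congr_mod n).
Proof. by move=> g h; rewrite /congr_mod -rpredN opprB. Qed.

Lemma congr_mod_trans n : transitive (congr_mod n).
Proof.
by move=> h g l gh hl; rewrite /congr_mod -(subrKA (val h)); apply: rpredD.
Qed.

Lemma gl3_integer g : val g \in integer_mx (k:=k).
Proof. by have /and3P[] := valP g. Qed.

Lemma congr_modMl n l g h : congr_mod n (l * g)%g (l * h)%g = congr_mod n g h.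
Proof.
have mul u g' h' : congr_mod n g' h' -> congr_mod n (u * g')%g (u * h')%g.
  move=> gh; rewrite /congr_mod /= -mulrBr -[n : int]add0r.
  exact: pideal_mxM (gl3_integer u) gh.
by apply/idP/idP => [/(mul l^-1%g)|/mul//]; rewrite !mulKg.
Qed.

Lemma congr_modMr n l g h : congr_mod n (g * l)%g (h * l)%g = congr_mod n g h.
Proof.
have mul u g' h' : congr_mod n g' h' -> congr_mod n (g' * u)%g (h' * u)%g.
  move=> gh; rewrite /congr_mod /= -mulrBl -[n : int]addr0.
  exact: pideal_mxM gh (gl3_integer u).
by apply/idP/idP => [/(mul l^-1%g)|/mul//]; rewrite !mulgK.
Qed.

Lemma congr_modV n g h : congr_mod n g^-1%g h^-1%g = congr_mod n g h.
Proof. by rewrite -(congr_modMl n g) -(congr_modMr n h) mulgV mulgVK mul1g congr_mod_sym. Qed.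

Lemma congr_mod_le m n g h : (m <= n)%N -> congr_mod n g h -> congr_mod m g h.
Proof.
move=> mn /mxOverP gh; apply/mxOverP => i j.
by apply: pideal_le (gh i j); rewrite lez_nat.
Qed.

Lemma congruence_subgroupE n g h : congr_mod n g h <-> congruence_subgroup n (g^-1 * h)%g.
Proof.
rewrite -(congr_modMl n g^-1%g) mulVg congr_mod_sym.
by split.
Qed.

(** Matrices are told apart modulo the [n]-th power of the maximal ideal by the
    position of their entries in a finite net. *)
Lemma congr_mod_reps n : exists r : GL3 k -> GL3 k, exists s : seq (GL3 k),
  [/\ uniq s, forall g, r g \in s, {in s, forall g, r g = g},
      forall g, congr_mod n (r g) g
    & forall g h, congr_mod n g h -> r g = r h].
Proof.
have [s hs] := pideal_net n.
pose digit x := find (fun y : k => x - y \in pideal n) s.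
have digit_lt x : x \in Rk -> (digit x < size s)%N.
  by move=> /hs[y ys xy]; rewrite -has_find; apply/hasP; exists y.
have digitE x y : x \in Rk -> y \in Rk -> (digit x == digit y) = (x - y \in pideal n).
  move=> ix iy; apply/eqP/idP => [e|hxy]; last first.
    by apply: eq_find => z; rewrite -(subrKA y) rpredDl.
  have hx := nth_find 0 (etrans (has_find _ _) (digit_lt x ix)).
  have hy := nth_find 0 (etrans (has_find _ _) (digit_lt y iy)).
  rewrite -(subrKA (nth 0 s (digit x))); apply: rpredD => //.
  by rewrite e -opprB rpredN.
pose code g : 'M['I_(size s).+1]_3 := \matrix_(i, j) inord (digit (val g i j)).
have codeE g h : (code g == code h) = congr_mod n g h.
  have ig i j : val g i j \in Rk by have /mxOverP := gl3_integer g; apply.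
  have ih i j : val h i j \in Rk by have /mxOverP := gl3_integer h; apply.
  apply/eqP/mxOverP => [/matrixP e i j|e].
    have := congr1 (@nat_of_ord _) (e i j); rewrite !mxE !inordK ?ltnS 1?ltnW ?digit_lt // => /eqP.
    by rewrite digitE.
  apply/matrixP => i j; rewrite !mxE; congr inord; apply/eqP; rewrite digitE //.
  by have := e i j; rewrite !mxE.
pose rep t := xget 1%g [set g | code g = t].
have codeK g : code (rep (code g)) = code g.
  by apply: (@xgetPex _ 1%g [set h | code h = code g]); exists g.
exists (rep \o code), [seq rep t | t <- enum 'M_3 & code (rep t) == t]; split.
- rewrite map_inj_in_uniq; first by apply: filter_uniq; apply: enum_uniq.
  move=> t u.
  by rewrite !mem_filter => /andP[/eqP et _] /andP[/eqP eu _] e; rewrite -et e.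
- by move=> g; apply: map_f; rewrite mem_filter mem_enum codeK eqxx.
- by move=> g /mapP[t]; rewrite mem_filter => /andP[/eqP e _] -> /=; rewrite e.
- by move=> g; rewrite -codeE /= codeK.
- by move=> g h; rewrite -codeE /= => /eqP ->.
Qed.

Variable R : realType.
Implicit Type f : GL3 k -> R[i].

Definition level n f := forall g h, congr_mod n g h -> f g = f h.

Lemma smoothP f : smooth f <-> exists n, level n f.
Proof.
split=> [] [n hf]; exists n; last first.
  by move=> h hh g; apply/esym/hf/congruence_subgroupE; rewrite mulKg.
move=> g h /congruence_subgroupE gh.
by have := hf _ gh g; rewrite mulVKg => ->.
Qed.

Lemma level_le m n f : (m <= n)%N -> level m f -> level n f.
Proof. by move=> mn hf g h /(congr_mod_le mn)/hf. Qed.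

Lemma level_conv n f1 f2 g : level n f1 -> level n f2 ->
  level n (fun h => f1 h * f2 (h^-1 * g)%g).
Proof.
move=> h1 h2 h l hl; congr (_ * _); first exact: h1.
by apply: h2; rewrite congr_modMr congr_modV.
Qed.

(** Up to normalization, summing a function of level [n] over such an [s] is
    integrating it against the Haar measure: the sum is invariant under every
    map that permutes the congruence classes, in particular under translations
    and inversion. *)
Definition class_sum n (s : seq (GL3 k)) :=
  (forall A : set (GL3 k), (forall g h, congr_mod n g h -> A g -> A h) ->
    A 1%g -> \sum_(g <- s) `[< A g >]%:R != 0 :> R[i]) /\
  (forall (sigma : GL3 k -> GL3 k) f,
    (forall g h, congr_mod n (sigma g) (sigma h) = congr_mod n g h) ->
    level n f -> \sum_(g <- s) f (sigma g) = \sum_(g <- s) f g).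

Lemma class_sum_exists n : exists s, class_sum n s.
Proof.
have [r [s [us rs rK rc rE]]] := congr_mod_reps n; exists s; split.
  move=> A hA A1; have Ar : A (r 1%g) by apply: hA A1; rewrite congr_mod_sym.
  rewrite (bigD1_seq _ (rs 1%g)) //= (asboolT Ar).
  rewrite gt_eqF // ltr_pwDl ?ltr01 //; apply: sumr_ge0 => x _; exact: ler0n.
move=> sigma f hsigma hf.
have inj : {in s &, injective (r \o sigma)}.
  move=> x y xs ys /= e; rewrite -(rK x xs) -(rK y ys); apply: rE.
  rewrite -hsigma; apply: (@congr_mod_trans _ (r (sigma x))).
    by rewrite congr_mod_sym.
  by rewrite e.
have perm : perm_eq [seq r (sigma g) | g <- s] s.
  have uniq_r : uniq [seq r (sigma g) | g <- s] by rewrite map_inj_in_uniq.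
  apply: uniq_perm => //; apply: (uniq_min_size uniq_r _ _).2; last by rewrite size_map.
  by move=> _ /mapP[g _ ->].
rewrite -[RHS](perm_big _ perm) big_map; apply: eq_bigr => g _.
by apply: hf; rewrite congr_mod_sym.
Qed.

End Congruence.

(** * Irreducibility of a subquotient *)

Section Subquotient.
Variables (C : fieldType) (G : groupType) (V : representation C G).
Variables W0 U0 : subrep V.
Local Notation Q := (quot_mod (restr_subrep U0 W0)).
Local Notation piQ := (\pi_Q%qT).
Local Notation inU f hf := (exist (fun v => v \in U0) f hf : sub_mod U0).

(** Submodules of the quotient are replaced by their preimages in [V], so that
    all computations take place in [V]. *)
Section Preimage.
Variable W : subrep (quot_rep (restr_subrep U0 W0)).

Definition preim_pred : {pred V} := fun f =>
  `[< exists hf : f \in U0, piQ (inU f hf) \in W >].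

Lemma preim_closed : submod_closed preim_pred.
Proof.
split=> [|a f g /asboolP[hf Wf] /asboolP[hg Wg]]; apply/asboolP.
  exists (rpred0 (subrep_pred U0)).
  rewrite (_ : piQ _ = 0); first exact: (rpred0 (subrep_pred W)).
  apply: (addrI (piQ 0)); rewrite addr0 quot_addE; congr (\pi _)%qT.
  by apply: val_inj; rewrite /= add0r.
have hfg : a *: f + g \in U0 by rewrite rpredD ?rpredZ.
exists hfg; rewrite (_ : inU _ _ = a *: inU f hf + inU g hg); last exact: val_inj.
by rewrite -quot_addE -quot_scaleE; apply: rpredD Wg; apply: rpredZ Wf.
Qed.

Lemma preim_stable g f : f \in preim_pred -> rep_act g f \in preim_pred.
Proof.
move=> /asboolP[hf /(subrep_stable g) Wf]; apply/asboolP.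
have e : inU (rep_act g f) (subrep_stable g hf) = rep_act g (inU f hf : sub_rep U0).
  exact: val_inj.
exists (subrep_stable g hf); rewrite e.
by move: Wf; rewrite [rep_act g _](quot_actE (restr_subrep U0 W0)).
Qed.

Definition preim_subrep : subrep V := Subrep preim_closed preim_stable.

End Preimage.

Lemma irreducible_subquotient :
    (exists2 v, v \in U0 & v \notin W0) ->
    (forall X : subrep V, (forall f, f \in W0 -> f \in U0 -> f \in X) ->
      (exists f, [/\ f \in X, f \in U0 & f \notin W0]) -> {subset U0 <= X}) ->
  irreducible (quot_rep (restr_subrep U0 W0)).
Proof.
have pi0 : piQ 0 = 0.
  apply: (addrI (piQ 0)); rewrite addr0 quot_addE; congr (\pi _)%qT.
  by apply: val_inj; rewrite /= add0r.
move=> [v Uv Wv] max; split.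
  exists (piQ (inU v Uv)); apply/eqP; rewrite -pi0 => /quot_eqP.
  by rewrite inE /= subr0 (negPf Wv).
move=> W; have [[f [hf [Wf nf]]]|none] := pselect
  (exists f, exists hf : f \in U0, piQ (inU f hf) \in W /\ f \notin W0).
- right=> x; rewrite -[x]reprK; case: (repr x) => u Uu.
  have /asboolP[Uu' Wu] : u \in preim_subrep W.
    apply: max Uu => [g Wg Ug|]; last by exists f; split=> //; apply/asboolP; exists hf.
    apply/asboolP; exists Ug; rewrite (_ : piQ _ = 0) ?(rpred0 (subrep_pred W)) //.
    by rewrite -pi0; apply/quot_eqP; rewrite inE /= subr0.
  by rewrite (bool_irrelevance Uu Uu').
- left=> x; rewrite -[x]reprK; case: (repr x) => u Uu Wu.
  rewrite -pi0; apply/quot_eqP; rewrite inE /= subr0.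
  by apply: contraT => nu; case: none; exists u, Uu.
Qed.

End Subquotient.

(** * The level filtration and the theorem *)

Section Levels.
Variables (R : realType) (k : padicField) (chi2 chi3 : k -> R[i]).
Hypotheses (hchi2 : character chi2) (hchi3 : character chi3).
Variables (M N : nat).
Hypotheses (hM : conductor chi2 M) (hN : conductor chi3 N).
Hypotheses (hMN : (M <= N)%N) (hN0 : (0 < N)%N).
Hypothesis hMN23 : conductor (fun x => chi2 x / chi3 x) N.
Local Notation Rk := (@integer_ring k).
Local Notation chi := (chi_C chi2 chi3 M).
Local Notation lev j := (M%:Z, N%:Z, j).
Local Notation Ulev j := (U chi2 chi3 M (lev j)).
Local Notation levels j := (N%:Z <= j <= N%:Z + M%:Z).
Implicit Types (g h c x y : GL3 k) (z t : k) (f : GL3 k -> R[i]) (j n : int).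
Implicit Type s : seq (GL3 k).
Hint Resolve entry_integer : core.

Let TN := Tset_levN hMN.
Let chiM' := chiM hchi2 hchi3 hM hN hMN hN0.
Let chi1' := chi1 hchi2 hchi3 M.
Let chiV' := chiV hchi2 hchi3 hM hN hMN hN0.

Definition left_equivariant j f := forall c g, Cgroup (lev j) c -> f (c * g)%g = chi c * f g.

Lemma in_Ulev j f : f \in Ulev j <-> (exists m, level m f) /\ left_equivariant j f.
Proof.
split=> [/asboolP[/smoothP sf ef]|[/smoothP sf ef]]; last apply/asboolP; split=> //.
- by move=> c g hc; apply: ef.
- by move=> c hc g; apply: ef.
Qed.

(** ** The generator of [U (M, N, j)] *)

Definition chi_ext j g : R[i] := if `[< Cgroup (lev j) g >] then chi g else 0.

Lemma chi_ext_in j g : Cgroup (lev j) g -> chi_ext j g = chi g.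
Proof. by move=> hg; rewrite /chi_ext asboolT. Qed.

Lemma chi_ext_notin j g : ~ Cgroup (lev j) g -> chi_ext j g = 0.
Proof. by move=> hg; rewrite /chi_ext asboolF. Qed.

Section OneLevel.
Variable n : int.
Hypothesis hn : levels n.

Let Nn : N%:Z <= n. Proof. by case/andP: hn. Qed.
Let Tn := Tset_lev hMN hn.
Let CN c (hc : Cgroup (lev n) c) := Cgroup_levN Nn hc.

Lemma chi_ext_biequivariant : biequivariant chi2 chi3 M N n (chi_ext n).
Proof.
move=> c g hc; have [hg|hg] := pselect (Cgroup (lev n) g).
  rewrite !chi_ext_in ?chiM' //; try exact: CN; exact: Cgroup_mul.
rewrite !chi_ext_notin ?mulr0 ?mul0r //.
  by move/(Cgroup_mulr _ Tn hc).
by move/(Cgroup_mull _ Tn hc).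
Qed.

Lemma biequivariant_level f (m : nat) : biequivariant chi2 chi3 M N n f -> n <= m%:Z -> level m f.
Proof.
move=> hf nm g h /congruence_subgroupE gh.
have hc := Cgroup_congruence hMN Nn nm gh.
have := (hf _ g hc).2; rewrite mulVKg => ->.
have Nm : (N <= m)%N by rewrite -lez_nat (le_trans Nn).
by rewrite (chi_congruence hchi2 hchi3 hM hN hMN hN0 Nm gh) mulr1.
Qed.

Lemma chi_ext_in_Ulev : chi_ext n \in Ulev n.
Proof.
apply/in_Ulev; split; last by move=> c g hc; have [] := chi_ext_biequivariant g hc.
by exists `|n|%N; apply: biequivariant_level chi_ext_biequivariant _; rewrite lez_abs.
Qed.

(** Left convolution by [chi_ext n] is a multiple of the projection onto the
    left equivariant functions. *)
Lemma sum_chi_ext s f : left_equivariant n f -> forall g,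
  \sum_(x <- s) chi_ext n x * f (x^-1 * g)%g
  = (\sum_(x <- s) `[< Cgroup (lev n) x >]%:R) * f g.
Proof.
move=> hf g; rewrite mulr_suml; apply: eq_bigr => x _.
have [hx|hx] := pselect (Cgroup (lev n) x); last first.
  by rewrite chi_ext_notin // asboolF ?mul0r.
rewrite chi_ext_in // hf; last exact: Cgroup_inv.
rewrite chiV'; last exact: CN.
rewrite mulrA mulfV ?asboolT //.
by apply: (chi_neq0 hchi2 hchi3 hM hN hMN hN0); apply: CN.
Qed.

Lemma volume_neq0 (m : nat) s : n <= m%:Z -> class_sum R m s ->
  \sum_(x <- s) `[< Cgroup (lev n) x >]%:R != 0 :> R[i].
Proof.
move=> nm [pos _]; apply: pos; last exact: Cgroup1.
move=> g h /congruence_subgroupE gh hg; rewrite -(mulVKg g h).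
by apply: Cgroup_mul => //; apply: Cgroup_congruence gh.
Qed.

Lemma rtransE g f h : (rep_act g (f : rtrans_rep k R) : GL3 k -> R[i]) h = f (h * g)%g.
Proof. by []. Qed.

Lemma sum_rtrans_rep s (F : GL3 k -> rtrans_rep k R) g :
  (\sum_(x <- s) F x : GL3 k -> R[i]) g = \sum_(x <- s) (F x : GL3 k -> R[i]) g.
Proof. exact: (big_morph (fun f : rtrans_rep k R => (f : GL3 k -> R[i]) g)). Qed.

Lemma chi_ext_generates (X : subrep (rtrans_rep k R)) :
  chi_ext n \in X -> {subset Ulev n <= X}.
Proof.
move=> hX f /in_Ulev[[m0 hm0] hf]; pose m := maxn m0 `|n|%N.
have nm : n <= m%:Z by rewrite (le_trans (lez_abs n)) // lez_nat leq_maxr.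
have hm : level m f by apply: level_le hm0; apply: leq_maxl.
have [s hs] := class_sum_exists k R m; have vol := volume_neq0 nm hs.
have -> : f = (\sum_(x <- s) `[< Cgroup (lev n) x >]%:R)^-1 *:
    \sum_(x <- s) f x^-1%g *: rep_act x (chi_ext n : rtrans_rep k R).
  apply/funext => g; apply: (mulfI vol).
  rewrite -[RHS]/(_ * (_ * (\sum_(x <- s) _ : GL3 k -> R[i]) g)) mulrA mulfV // mul1r.
  rewrite sum_rtrans_rep -sum_chi_ext //.
  have hl := level_conv g (biequivariant_level chi_ext_biequivariant nm) hm.
  rewrite -(hs.2 (fun x => g * x)%g _ _ hl); last by move=> x y; rewrite congr_modMl.
  by apply: eq_bigr => x _; rewrite invgM mulgVK mulrC.
apply: rpredZ; apply: rpred_sum => x _; apply: rpredZ.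
exact: subrep_stable.
Qed.

(** Averaging a left equivariant function on the right over [Cgroup] gives a
    biequivariant function, with the same value at 1 up to the volume. *)
Definition right_average s f g := \sum_(x <- s) f (g * x)%g * chi_ext n x^-1%g.

Lemma right_average_mem (X : subrep (rtrans_rep k R)) s f :
  f \in X -> right_average s f \in X.
Proof.
move=> fX; have -> : right_average s f =
    \sum_(x <- s) chi_ext n x^-1%g *: rep_act x (f : rtrans_rep k R).
  by apply/funext => g; rewrite sum_rtrans_rep; apply: eq_bigr => x _; rewrite mulrC.
by apply: rpred_sum => x _; apply: rpredZ; apply: subrep_stable.
Qed.

Lemma right_average1 s f : left_equivariant n f ->
  right_average s f 1%g = (\sum_(x <- s) `[< Cgroup (lev n) x >]%:R) * f 1%g.
Proof.
move=> hf; rewrite mulr_suml; apply: eq_bigr => x _; rewrite mul1g.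
have [hx|hx] := pselect (Cgroup (lev n) x); last first.
  rewrite chi_ext_notin ?asboolF ?mulr0 ?mul0r // => /(Cgroup_inv Tn).
  by rewrite invgK.
have hx' := Cgroup_inv Tn hx; rewrite chi_ext_in // asboolT // mul1r.
rewrite -{1}[x]mulg1 hf // mulrAC -chiM'; try exact: CN.
by rewrite mulgV chi1' mul1r.
Qed.

Lemma right_average_biequivariant (m : nat) s f :
  class_sum R m s -> n <= m%:Z -> level m f -> left_equivariant n f ->
  biequivariant chi2 chi3 M N n (right_average s f).
Proof.
move=> [_ inv] nm lf hf c g hc; split.
  rewrite /right_average mulr_sumr; apply: eq_bigr => x _.
  by rewrite -mulgA (hf c) ?mulrA.
have lF : level m (fun x => f (g * x)%g * (chi_ext n x^-1%g * chi c)).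
  move=> x y xy; congr (_ * (_ * _)); first by apply: lf; rewrite congr_modMl.
  by apply: (biequivariant_level chi_ext_biequivariant nm); rewrite congr_modV.
rewrite /right_average mulr_suml.
under [RHS]eq_bigr do rewrite -mulrA.
rewrite -[RHS](inv (fun x => c * x)%g _ _ lF); last by move=> x y; rewrite congr_modMl.
apply: eq_bigr => x _; rewrite mulgA; congr (_ * _).
by rewrite -(chi_ext_biequivariant _ hc).2 invgM mulgVK.
Qed.

End OneLevel.

(** ** One step of the filtration *)

Let support n (hn : levels n) :=
  biequivariant_support hchi2 hchi3 hM hN hMN hN0 hMN23 hn.

Lemma biequivariant_N f : biequivariant chi2 chi3 M N N%:Z f ->
  forall g, f g = f 1%g * chi_ext N%:Z g.
Proof.
have hN' : levels N%:Z by rewrite lexx lerDl lez_nat leq0n.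
move=> hf g; have [hg|hg] := pselect (Cgroup (lev N%:Z) g).
  by rewrite chi_ext_in // -{1}[g]mul1g (hf g 1%g hg).2.
rewrite chi_ext_notin // mulr0; apply: contra_notP hg => /eqP.
exact: (support hN').
Qed.

(** Conjugation by [diag (t, 1, 1)], on which [chi] is trivial, rescales the
    entry of [lower31 z] by a unit. *)
Lemma biequivariant_lower31_unit n f z t : biequivariant chi2 chi3 M N n f ->
  z \in Rk -> t \in unit_group 0 -> f (lower31 (t * z)) = f (lower31 z).
Proof.
move=> hf iz ut; have it := unit_integer ut.
have itz : t * z \in Rk by apply: pideal_mull.
have [||d [_ [_ ed _]]] := @transvection_pair k 1%g 1 1 (t - 1).
- by apply: rpredB => //; apply: integer1.
- by rewrite entry1 eqxx mulr1 addrC subrK.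
have hd : Cgroup (lev n) d.
  by split; rewrite ed entry1 /= !inord3E /= !(mulr0, mul0r, addr0) pideal0.
have chid : chi d = 1.
  rewrite /chi_C !ed !entry1 /= !inord3E /= !(mulr0, mul0r, addr0).
  by rewrite (character1 hchi2) (character1 hchi3) mulr1 if_same.
have e : (d * lower31 (t * z))%g = (lower31 z * d)%g.
  apply: GL3_eq => i j.
  case: i => [|[|[|[|//]]]] // _; case: j => [|[|[|[|//]]]] // _;
    rewrite !entryM !(entry_lower31 _ _ itz, entry_lower31 _ _ iz) !ed !entry1 /=;
    rewrite !inord3E /=; ring.
have := (hf d (lower31 (t * z)) hd).1; rewrite chid mul1r => <-.
by rewrite e (hf d _ hd).2 chid mulr1.
Qed.

Variable m : nat.
Hypotheses (hm : levels m%:Z) (hm1 : levels m.+1%:Z).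

Let M0 : (0 < M)%N.
Proof.
case: (posnP M) => // M0; case/andP: hm => Nm _; case/andP: hm1 => _.
by rewrite M0 addr0 => m1N; have := le_trans m1N Nm; rewrite lez_nat ltnn.
Qed.

Let Nm : N%:Z <= m%:Z. Proof. by case/andP: hm. Qed.

Lemma Cgroup_lower31_factor g : Cgroup (lev N%:Z) g ->
  exists z c, [/\ z \in pideal N%:Z, Cgroup (lev m.+1%:Z) c & g = (lower31 z * c)%g]
    /\ (Cgroup (lev m%:Z) g -> z \in pideal m%:Z).
Proof.
move=> hg; have u11 := Cgroup_unit11 hN0 M0 hg; case: (hg) => g21 g32 g31.
have iu := unit_integer (unit_inv u11).
have iz : entry g 3 1 / entry g 1 1 \in Rk by apply: pideal_mull; rewrite // mulrC pideal_mull.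
exists (entry g 3 1 / entry g 1 1), (lower31 (- (entry g 3 1 / entry g 1 1)) * g)%g.
split; first split.
- exact: pideal_mulr.
- split; rewrite entryM !entry_lower31 ?rpredN //= !inord3E /=.
  + by rewrite !mulr0 !addr0 mul0r mul1r mul0r add0r addr0.
  + rewrite !(mulr0, mulr1, mul1r, mul0r, addr0, add0r) mulNr addrC.
    by apply: rpredB => //; apply: pideal_mulr => //; apply: pideal_mulr.
  + rewrite !(mulr0, mulr1, mul1r, mul0r, addr0, add0r) mulNr divfK ?unit_neq0 //.
    by rewrite addNr pideal0.
- by rewrite mulgA lower31_mul ?rpredN // subrr lower310 mul1g.
- by case=> _ _ h; apply: pideal_mulr.
Qed.

(** The value of [f] at [lower31 z] depends on the valuation of [z] only.
    Subtracting a suitable multiple of [chi_ext m.+1], which lives on valuations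
    greater than [m], makes the values for valuation [m] and beyond agree; this
    is all that equivariance under the larger group requires. *)
Lemma biequivariant_step f : biequivariant chi2 chi3 M N m.+1%:Z f ->
  exists a, left_equivariant m%:Z (fun g => f g - a * chi_ext m.+1%:Z g).
Proof.
have [p p0 vp] := pval_uniformizer k.
move=> hf; pose a := f 1%g - f (lower31 (p ^+ m)).
have he := chi_ext_biequivariant hm1.
exists a; set f1 := fun g => _.
have hf1 : biequivariant chi2 chi3 M N m.+1%:Z f1.
  move=> c g hc; rewrite /f1 (hf c g hc).1 (hf c g hc).2 (he c g hc).1 (he c g hc).2.
  by split; ring.
have ile z (j : nat) : z \in pideal j%:Z -> z \in Rk by apply: pideal_le.
have vpm := pval_exp m p0 vp.
have ipm : p ^+ m \in Rk by apply: (ile _ m); rewrite !inE vpm lexx orbT.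
have H0 z : z \in pideal m%:Z -> f1 (lower31 z) = f (lower31 (p ^+ m)).
  move=> hz; have iz := ile _ _ hz.
  have [hz1|hz1] := boolP (z \in pideal m.+1%:Z).
    have hl := Cgroup_lower31 M%:Z N%:Z iz hz1.
    rewrite /f1 chi_ext_in // -[lower31 z]mulg1 (hf _ 1%g hl).1 mulg1.
    by rewrite (chi_lower31 hchi2 hchi3 M iz) mul1r mulr1 /a subKr.
  rewrite /f1 chi_ext_notin; last first.
    by case=> _ _; rewrite entry_lower31 //= !inord3E /= add0r mulr1 (negPf hz1).
  rewrite mulr0 subr0 -[z](divfK (expf_neq0 m p0)).
  apply: biequivariant_lower31_unit hf ipm _.
  move: hz1; rewrite notin_pideal => /andP[z0 zm]; rewrite unit0E mulf_neq0 ?invr_eq0 ?expf_neq0 //.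
  rewrite pvalM ?invr_eq0 ?expf_neq0 // pval_inv ?expf_neq0 // vpm subr_eq0 eq_le.
  by move: hz; rewrite inE (negPf z0) /= => ->; rewrite andbT -ltzD1 addrC.
have H z t : z \in pideal N%:Z -> t \in pideal m%:Z ->
    f1 (lower31 (t + z)) = f1 (lower31 z).
  move=> hz ht; have [hzm|hzm] := boolP (z \in pideal m%:Z).
    by rewrite !H0 //; apply: rpredD.
  have z0 : z != 0 by apply: contraNneq hzm => ->; apply: pideal0.
  have -> : t + z = (1 + t / z) * z by rewrite mulrDl mul1r divfK // addrC.
  apply: biequivariant_lower31_unit hf1 (ile _ _ hz) _.
  by apply: unit_addr (unit1 k) _; apply: pideal_div hzm _; rewrite addrK.
move=> c g hc; have hcN := Cgroup_levN Nm hc.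
have [hg|hg] := pselect (Cgroup (lev N%:Z) g); last first.
  have z1 g' : ~ Cgroup (lev N%:Z) g' -> f1 g' = 0.
    by apply: contra_notP => /eqP; apply: (support hm1).
  rewrite !z1 ?mulr0 //; by move/(Cgroup_mull _ TN hcN).
have [t [c0 [[_ hc0 ec] /(_ hc) ht]]] := Cgroup_lower31_factor hcN.
have Nm1 : N%:Z <= m.+1%:Z by case/andP: hm1.
have hc0N := Cgroup_levN Nm1 hc0.
have it := ile _ _ ht.
have htN := Cgroup_lower31 M%:Z N%:Z it (pideal_le Nm ht).
rewrite ec chiM' // (chi_lower31 hchi2 hchi3 M it) mul1r -(hf1 c0 g hc0).1 -mulgA.
have [z [c1 [[hz hc1 ->] _]]] := Cgroup_lower31_factor (Cgroup_mul TN hc0N hg).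
rewrite mulgA. rewrite (lower31_mul it (ile _ _ hz)). 
by rewrite (hf1 c1 (lower31 (t + z)) hc1).2 (hf1 c1 (lower31 z) hc1).2 H.
Qed.

Lemma chi_ext_succ_notin_Ulev : chi_ext m.+1%:Z \notin Ulev m%:Z.
Proof.
apply/negP => /in_Ulev[_ he].
have [p p0 vp] := pval_uniformizer k; have vpm := pval_exp m p0 vp.
have hp : p ^+ m \in pideal m%:Z by rewrite !inE vpm lexx orbT.
have ip : p ^+ m \in Rk by apply: pideal_le hp.
have := he _ 1%g (Cgroup_lower31 M%:Z N%:Z ip hp).
rewrite mulg1 (chi_lower31 hchi2 hchi3 M ip) mul1r (chi_ext_in (Cgroup1 _ _)) chi1'.
rewrite chi_ext_notin => [/esym/eqP|]; first by rewrite oner_eq0.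
case=> _ _; rewrite entry_lower31 //= !inord3E /= add0r mulr1 inE vpm.
by rewrite lez_nat ltnn orbF expf_eq0 (negPf p0) andbF.
Qed.

End Levels.

Section Conclusion.
Variables (R : realType) (k : padicField) (chi2 chi3 : k -> R[i]).
Hypotheses (hchi2 : character chi2) (hchi3 : character chi3).
Variables (M N : nat).
Hypotheses (hM : conductor chi2 M) (hN : conductor chi3 N).
Hypotheses (hMN : (M <= N)%N) (hN0 : (0 < N)%N).
Hypothesis hMN23 : conductor (fun x => chi2 x / chi3 x) N.
Local Notation chi := (chi_C chi2 chi3 M).
Local Notation lev j := (M%:Z, N%:Z, j).
Local Notation Ulev j := (U chi2 chi3 M (lev j)).
Local Notation Ubelow j := (U_below chi2 chi3 M N (lev j)).
Local Notation levels j := (N%:Z <= j <= N%:Z + M%:Z).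
Local Notation ext j := (chi_ext chi2 chi3 M N j).
Implicit Types (f : rtrans_rep k R) (g c x y : GL3 k) (X : subrep (rtrans_rep k R)).

(** ** The modules below [U (M, N, n)] *)

Lemma U_below_N f : f \in Ubelow N%:Z -> f = 0.
Proof.
move=> /asboolP[l [w [hw ->]]]; apply: big1 => i _.
have [[[d1 d2] d3] [[_ [l1 l2 l3]] [[l1' l2' l3'] ne]] _] := hw i.
by case: ne; congr (_, _, _); apply/eqP; rewrite eq_le ?l1 ?l2 ?l3 ?l1' ?l2' ?l3'.
Qed.

Lemma U_below_succ (m : nat) : levels m%:Z -> Ubelow m.+1%:Z =i Ulev m%:Z.
Proof.
move=> hm f; apply/idP/idP => [/asboolP[l [w [hw ->]]]|hf].
  apply: rpred_sum => i _.
  have [[[d1 d2] d3] [[_ [l1 l2 l3]] [[l1' l2' l3'] ne]]] := hw i.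
  apply: U_mono; split=> //; rewrite -ltzD1 -[m%:Z + 1]/(m%:Z + 1%:Z) -PoszD addn1.
  rewrite lt_neqAle l3' andbT; apply/eqP => e; case: ne.
  by congr (_, _, _) => //; apply/eqP; rewrite eq_le ?l1 ?l2 ?l1' ?l2'.
apply/asboolP; exists 1%N, (fun=> f); split; last by rewrite big_ord1.
move=> _; exists (lev m%:Z) => //; split.
  split; first exact: Tset_lev.
  by split=> //; case/andP: hm.
split; first by split=> //; rewrite lez_nat.
by case=> /eqP; rewrite -addn1 -{1}[m]addn0 eqn_add2l.
Qed.

(** ** Maximality of [U_below] *)

Lemma rtrans_rep_neq0 f : f != 0 -> exists x, (f : GL3 k -> R[i]) x != 0.
Proof.
apply: contra_neqP => /forallNP h; apply/funext => x.
by apply/eqP; apply: contraT => /h.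
Qed.

(** A translate of [f] is nonzero at 1, hence so is its average, and at the
    lowest level the biequivariant functions are the multiples of the
    generator. *)
Lemma chi_ext_mem_N X f : f \in X -> f \in Ulev N%:Z -> f != 0 -> (ext N%:Z : rtrans_rep k R) \in X.
Proof.
have hl : levels N%:Z by rewrite lexx lerDl lez_nat leq0n.
move=> fX fU f0; have [x fx] := rtrans_rep_neq0 f0.
pose f1 := rep_act x f.
have f1X : f1 \in X by apply: subrep_stable.
have /in_Ulev[[m0 hm0] hf1] : f1 \in Ulev N%:Z by apply: subrep_stable.
pose m := maxn m0 N; have hm : level m f1 by apply: level_le hm0; apply: leq_maxl.
have nm : N%:Z <= m%:Z by rewrite lez_nat leq_maxr.
have [s hs] := class_sum_exists k R m.
have vol := volume_neq0 hMN hl nm hs.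
pose h := right_average chi2 chi3 M N N%:Z s f1.
have hX : (h : rtrans_rep k R) \in X by apply: right_average_mem.
have bh : biequivariant chi2 chi3 M N N%:Z h by apply: right_average_biequivariant hs nm hm hf1.
have h1 : h 1%g != 0.
  by rewrite /h right_average1 // mulf_neq0 // /f1 rtransE mul1g.
have -> : ext N%:Z = (h 1%g)^-1 *: (h : rtrans_rep k R).
  have hE := biequivariant_N hchi2 hchi3 hM hN hMN hN0 hMN23 bh.
  by apply/funext => g; rewrite -[RHS]/(_ * h g) (hE g) mulrA mulVf ?mul1r.
exact: rpredZ.
Qed.

(** The component of [f] in the kernel of the projection [P] to [Ulev m] is
    nonzero, and it stays in this kernel under translation and averaging, since
    [P] acts on the left. The resulting biequivariant [h] is congruent to
    [a * ext m.+1] modulo [Ulev m]; if [a] were 0 then [h] would belong to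
    [Ulev m], hence be a multiple of [P h = 0]. *)
Lemma chi_ext_mem_succ (m : nat) X f : levels m%:Z -> levels m.+1%:Z ->
  {subset Ulev m%:Z <= X} -> f \in X -> f \in Ulev m.+1%:Z -> f \notin Ulev m%:Z ->
  (ext m.+1%:Z : rtrans_rep k R) \in X.
Proof.
move=> hm hm1 UX fX /in_Ulev[[l0 hl0] hf] nf.
pose l := maxn l0 m.+1; have lf : level l f by apply: level_le hl0; apply: leq_maxl.
have ml : m%:Z <= l%:Z by rewrite lez_nat (leq_trans (leqnSn m)) ?leq_maxr.
have m1l : m.+1%:Z <= l%:Z by rewrite lez_nat leq_maxr.
have [s hs] := class_sum_exists k R l.
have vol := volume_neq0 hMN hm ml hs; have vol1 := volume_neq0 hMN hm1 m1l hs.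
set v := \sum_(x <- s) _ in vol; set v1 := \sum_(x <- s) _ in vol1.
have le := biequivariant_level hchi2 hchi3 hM hN hMN hN0 hm
  (chi_ext_biequivariant hchi2 hchi3 hM hN hMN hN0 hm) ml.
(* Multiplied by the volume [v], this is the projection to [Ulev m]. *)
pose P (u : GL3 k -> R[i]) : rtrans_rep k R :=
  fun g => \sum_(x <- s) ext m%:Z x * u (x^-1 * g)%g.
have equivP u : level l u -> left_equivariant chi2 chi3 M N m%:Z (P u).
  move=> lu c g hc.
  rewrite /P -(hs.2 (fun x => c * x)%g _ _ (level_conv _ le lu)); last first.
    by move=> x y; rewrite congr_modMl.
  rewrite mulr_sumr; apply: eq_bigr => x _; rewrite mulrA; congr (_ * _).
    by rewrite (chi_ext_biequivariant hchi2 hchi3 hM hN hMN hN0 hm x hc).1.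
  by rewrite invgM -!mulgA mulKg.
have lP u : level l u -> level l (P u).
  move=> lu x y xy; apply: eq_bigr => z _; congr (_ * _).
  by apply: lu; rewrite congr_modMl.
have PK u : left_equivariant chi2 chi3 M N m%:Z u -> forall g, P u g = v * u g.
  by move=> hu g; apply: sum_chi_ext.
pose f0 : rtrans_rep k R := v *: f - P f.
have f0E g : (f0 : GL3 k -> R[i]) g = v * (f : GL3 k -> R[i]) g - P f g by [].
have PfU : P f \in Ulev m%:Z by apply/in_Ulev; split; [exists l; apply: lP | exact: equivP].
have f0X : f0 \in X by apply: rpredB; [apply: rpredZ | apply: UX].
have f0U : f0 \in Ulev m.+1%:Z.
  apply: rpredB; first by apply: rpredZ; apply/in_Ulev; split=> //; exists l0.
  by apply: U_mono PfU; split=> //; rewrite lez_nat.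
have Pf0 g : P f0 g = 0.
  rewrite {1}/P; under eq_bigr do rewrite f0E mulrBr mulrCA.
  by rewrite sumrB -mulr_sumr -/(P f g) -/(P (P f) g) (PK _ (equivP _ lf)) subrr.
have [x fx] : exists x, (f0 : GL3 k -> R[i]) x != 0.
  apply: rtrans_rep_neq0; apply: contraNneq nf => /eqP; rewrite subr_eq0 => /eqP e.
  by rewrite -[f](scalerK vol) e; apply: rpredZ.
pose f1 := rep_act x f0.
have f1X : f1 \in X by apply: subrep_stable.
have /in_Ulev[_ hf1] : f1 \in Ulev m.+1%:Z by apply: subrep_stable.
have lf1 : level l f1.
  move=> y z yz; rewrite /f1 !rtransE !f0E (lf _ (z * x)%g) ?(lP _ lf _ (z * x)%g) //;
    by rewrite congr_modMr.
pose h := right_average chi2 chi3 M N m.+1%:Z s f1.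
have hX : (h : rtrans_rep k R) \in X by apply: right_average_mem.
have bh : biequivariant chi2 chi3 M N m.+1%:Z h.
  by apply: right_average_biequivariant hs m1l lf1 hf1.
have h1 : h 1%g != 0.
  by rewrite /h right_average1 // mulf_neq0 // /f1 rtransE mul1g.
have Ph g : P h g = 0.
  rewrite /P /h /right_average.
  under eq_bigr do rewrite mulr_sumr.
  rewrite exchange_big /=; apply: big1 => y _.
  under eq_bigr do rewrite mulrA.
  rewrite -mulr_suml; have := Pf0 (g * y * x)%g; rewrite /P => e.
  by under eq_bigr do rewrite /f1 rtransE -!mulgA; rewrite -!mulgA in e; rewrite e mul0r.
have [a ha] := biequivariant_step hchi2 hchi3 hM hN hMN hN0 hMN23 hm hm1 bh.
have [a0|a0] := eqVneq a 0.
  case/eqP: h1; apply: (mulfI vol); rewrite mulr0 -(Ph 1%g) PK // => c g hc.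
  by have := ha c g hc; rewrite a0 !mul0r !subr0.
have h2U : (fun g => h g - a * ext m.+1%:Z g : R[i]) \in Ulev m%:Z.
  apply/in_Ulev; split=> //; exists l => y z yz.
  have lh := biequivariant_level hchi2 hchi3 hM hN hMN hN0 hm1 bh m1l.
  have lx := biequivariant_level hchi2 hchi3 hM hN hMN hN0 hm1
    (chi_ext_biequivariant hchi2 hchi3 hM hN hMN hN0 hm1) m1l.
  by rewrite (lh _ _ yz) (lx _ _ yz).
have -> : ext m.+1%:Z = a^-1 *: ((h : rtrans_rep k R) -
    (fun g => h g - a * ext m.+1%:Z g : R[i])).
  apply/funext => g; rewrite -[RHS]/(_ * (_ - _)) subKr mulrA mulVf ?mul1r //.
by apply: rpredZ; apply: rpredB => //; apply: UX.
Qed.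

End Conclusion.

Theorem theorem4p1 (R : realType) (k : padicField) (p q : nat)
    (hp : residue_char k p) (hp2 : (2 < p)%N)
    (hq : (residue_field k #= `I_q)%card) (hq3 : (3 < q)%N)
    (chi2 chi3 : k -> R[i])
    (hchi2 : character chi2) (hchi3 : character chi3)
    (M N : nat) (hM : conductor chi2 M) (hN : conductor chi3 N)
    (hMN : (M <= N)%N) (hN0 : (0 < N)%N)
    (hMN23 : conductor (fun x => chi2 x / chi3 x) N)
    (n : int) (hn : N%:Z <= n <= N%:Z + M%:Z) :
  irreducible (V chi2 chi3 M N (M%:Z, N%:Z, n)).
Proof.
have extU := chi_ext_in_Ulev hchi2 hchi3 hM hN hMN hN0 hn.
have gen := chi_ext_generates hchi2 hchi3 hM hN hMN hN0 hn.
have ext1 : chi_ext chi2 chi3 M N n 1%g = 1.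
  by rewrite chi_ext_in ?(chi1 hchi2 hchi3) //; apply: Cgroup1.
case: (eqVneq n N%:Z) => [nN|nN].
  rewrite nN in extU gen ext1 *; apply: irreducible_subquotient.
    exists (chi_ext chi2 chi3 M N N%:Z) => //; apply/negP => /U_below_N e.
    by move: ext1; rewrite e => /esym/eqP; rewrite oner_eq0.
  move=> X _ [f [fX fU nf]]; apply: gen.
  apply: (chi_ext_mem_N hchi2 hchi3 hM hN hMN hN0 hMN23 fX fU).
  by apply: contraNneq nf => ->; apply: rpred0.
have {nN} Nn : N%:Z < n by rewrite lt_neqAle eq_sym nN; case/andP: hn.
case: n => [[|m]|m] // in hn extU gen ext1 Nn *.
have hm : N%:Z <= m%:Z <= N%:Z + M%:Z.
  move: Nn hn; rewrite -!PoszD !lez_nat ltz_nat => Nm /andP[_ mNM].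
  by rewrite -ltnS Nm ltnW.
have below := U_below_succ chi2 chi3 hMN hm.
apply: irreducible_subquotient.
  exists (chi_ext chi2 chi3 M N m.+1%:Z) => //; rewrite below.
  exact: chi_ext_succ_notin_Ulev.
move=> X WX [f [fX fU nf]]; apply: gen; rewrite below in nf.
apply: (chi_ext_mem_succ hchi2 hchi3 hM hN hMN hN0 hMN23 hm hn _ fX fU nf) => u uU.
apply: WX; first by rewrite below.
by apply: U_mono uU; split=> //; rewrite lez_nat.
Qed.
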